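(* Let $\mathbb{O}_2$ be the $\mathrm{L}_3(4)$ near octagon, defined on the central involutions of $G_2=\mathrm{L}_3(4){:}2^2$. Then $\mathrm{Aut}(\mathbb{O}_2)\cong \mathrm{L}_3(4){:}2^2$, and the automorphisms of $\mathbb{O}_2$ are precisely the conjugations by elements of $\mathrm{L}_3(4){:}2^2$ (acting on the points of $\mathbb{O}_2$, i.e. on the central involutions).
   Context: The group $\mathrm{L}_3(4)=\mathrm{PSL}_3(4)$ has $\mathrm{Aut}(\mathrm{L}_3(4))\cong \mathrm{L}_3(4){:}D_{12}$, which has a unique conjugacy class of subgroups of type $\mathrm{L}_3(4){:}2^2$; $\mathrm{L}_3(4){:}2^2$ denotes any group isomorphic to such a subgroup. Concretely it is the group of all collineations and correlations of $\mathrm{PG}(2,4)$ whose associated $3\times 3$ matrix over $\mathbb{F}_4$ (with respect to a fixed basis and its dual basis, together with an associated field automorphism) has determinant $1$; the determinant is well defined since $k^3=1$ for all $k\in\mathbb{F}_4\setminus\{0\}$. An involution $\sigma$ of a finite group $G$ is central if there is a Sylow $2$-subgroup $H$ of $G$ with $\sigma\in C_G(H)$. $\mathbb{O}_2$ is the point-line geometry whose points are the $315$ central involutions of $G_2$ and whose lines are all three element subsets $\{x,y,xy\}$ where $x,y$ are two distinct commuting central involutions of $G_2$ with $[G_2:N_{G_2}(\langle x,y\rangle)]\in\{105,420\}$; incidence is containment. It is a near octagon of order $(2,4)$. An automorphism of $\mathbb{O}_2$ is a permutation of the points that maps lines to lines. *)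

(* Defs.v *)
From HB Require Import structures.
From mathcomp Require Import all_boot all_order all_algebra.
From mathcomp Require Import all_fingroup all_solvable.

Set Implicit Arguments.
Unset Strict Implicit.
Unset Printing Implicit Defensive.

Import GRing.Theory.
Local Open Scope group_scope.

Section ProjectivePlane.

Variable F : finFieldType.
Local Open Scope ring_scope.

(* The point of PG(2,F) with coordinates v, as the set of multiples of v. *)
Definition pt (v : 'cV[F]_3) : {set 'cV[F]_3} := [set k *: v | k : F].

(* The line of PG(2,F) with dual coordinates a, i.e. the plane a^T x = 0. *)
Definition ln (a : 'cV[F]_3) : {set 'cV[F]_3} := [set x | a^T *m x == 0].

Definition is_pg_elt (S : {set 'cV[F]_3}) : bool :=
  [exists v : 'cV[F]_3, (v != 0) && ((S == pt v) || (S == ln v))].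

(* The points and lines of PG(2,F); incidence is inclusion. *)
Definition pg_elt := {S : {set 'cV[F]_3} | is_pg_elt S}.

Definition collineation (g : {perm pg_elt}) : bool :=
  [forall x, forall y, (val (g x) \subset val (g y)) == (val x \subset val y)].

Definition correlation (g : {perm pg_elt}) : bool :=
  [forall x, forall y, (val (g x) \subset val (g y)) == (val y \subset val x)].

Definition field_aut (t : {perm F}) : bool :=
  [&& t 1 == 1, [forall a, forall b, t (a + b) == t a + t b]
    & [forall a, forall b, t (a * b) == t a * t b]].

(* A collineation maps the point with coordinates v to the point with
   coordinates A v^t. *)
Definition collineation_mx (g : {perm pg_elt}) (A : 'M[F]_3) (t : {perm F}) :=
  collineation g &&
  [forall x : pg_elt, forall v : 'cV[F]_3, (v != 0) && (val x == pt v) ==>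
     (val (g x) == pt (A *m map_mx t v))].

(* A correlation maps the point with coordinates v to the line whose
   coordinates with respect to the dual basis are A v^t. *)
Definition correlation_mx (g : {perm pg_elt}) (A : 'M[F]_3) (t : {perm F}) :=
  correlation g &&
  [forall x : pg_elt, forall v : 'cV[F]_3, (v != 0) && (val x == pt v) ==>
     (val (g x) == ln (A *m map_mx t v))].

(* A is only determined by g up to a nonzero scalar k, which multiplies \det A
   by k ^+ 3; when #|F| = 4 this is 1, so the determinant depends only on g. *)
Definition coll_corr_det1 : {set {perm pg_elt}} :=
  [set g | [exists A : 'M[F]_3, exists t : {perm F},
     [&& field_aut t, \det A == 1
       & collineation_mx g A t || correlation_mx g A t]]].

Lemma is_pg_pt (v : 'cV[F]_3) : v != 0 -> is_pg_elt (pt v).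
Proof. by move=> nz; apply/existsP; exists v; rewrite nz eqxx. Qed.

Lemma is_pg_ln (v : 'cV[F]_3) : v != 0 -> is_pg_elt (ln v).
Proof. by move=> nz; apply/existsP; exists v; rewrite nz eqxx orbT. Qed.

Lemma pg_eltP (x : pg_elt) :
  exists2 v : 'cV[F]_3, v != 0 & val x = pt v \/ val x = ln v.
Proof.
have /existsP[v /andP[nz /orP[] /eqP e]] := valP x; exists v => //; by [left | right].
Qed.

Lemma mem_pt (v : 'cV[F]_3) : v \in pt v.
Proof. by apply/imsetP; exists 1; rewrite ?scale1r. Qed.

Lemma pt_sub_pg (x : pg_elt) (v : 'cV[F]_3) : (pt v \subset val x) = (v \in val x).
Proof.
apply/idP/idP => [/subsetP|vx]; first by apply; apply: mem_pt.
apply/subsetP=> _ /imsetP[k _ ->]; have [w _ [] e] := pg_eltP x.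
  by move: vx; rewrite e => /imsetP[l _ ->]; apply/imsetP; exists (k * l); rewrite ?scalerA.
by move: vx; rewrite e !inE -scalemxAr => /eqP->; rewrite scaler0.
Qed.

Lemma ln_sym (v w : 'cV[F]_3) : (v \in ln w) = (w \in ln v).
Proof. by rewrite !inE -(inj_eq trmx_inj) trmx_mul trmxK trmx0. Qed.

Lemma zero_pg (x : pg_elt) : 0 \in val x.
Proof.
have [w _ [] ->] := pg_eltP x; last by rewrite inE mulmx0.
by apply/imsetP; exists 0; rewrite ?scale0r.
Qed.

Lemma sub_pt_pg (x y : pg_elt) (v w : 'cV[F]_3) :
  val x = pt v -> val y = ln w -> (val x \subset val y) = (w^T *m v == 0).
Proof. by move=> -> ey; rewrite pt_sub_pg ey inE. Qed.

Lemma pg_elt_eq (x y : pg_elt) :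
  (forall v : 'cV[F]_3, v != 0 -> (v \in val x) = (v \in val y)) -> x = y.
Proof.
move=> h; apply/val_inj/setP=> v; have [->|/h //] := eqVneq v 0.
by rewrite !zero_pg.
Qed.

Lemma field_autP (t : {perm F}) :
  field_aut t -> exists f : {rmorphism F -> F}, f =1 t.
Proof.
case/and3P=> /eqP t1 /forallP tD /forallP tM.
have {}tD a b : t (a + b) = t a + t b by apply/eqP; move/forallP: (tD a); apply.
have {}tM a b : t (a * b) = t a * t b by apply/eqP; move/forallP: (tM a); apply.
have t0 : t 0 = 0 by apply: (addrI (t 0)); rewrite -tD !addr0.
pose f0 : F -> F := t.
have zf : zmod_morphism f0.
  move=> a b; apply: (addIr (t b)); by rewrite /f0 -tD !subrK.
have mf : monoid_morphism f0 by split.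
pose f : {rmorphism F -> F} := HB.pack f0
  (GRing.isZmodMorphism.Build F F f0 zf) (GRing.isMonoidMorphism.Build F F f0 mf).
by exists f.
Qed.

Lemma field_aut1 : field_aut 1%g.
Proof.
apply/and3P; split; first by rewrite perm1.
  by apply/forallP=> a; apply/forallP=> b; rewrite !perm1.
by apply/forallP=> a; apply/forallP=> b; rewrite !perm1.
Qed.

Lemma field_autM (s t : {perm F}) :
  field_aut s -> field_aut t -> field_aut (s * t)%g.
Proof.
move=> /field_autP[f ef] /field_autP[h eh].
apply/and3P; split; first by rewrite permM -ef -eh !rmorph1.
  by apply/forallP=> a; apply/forallP=> b; rewrite !permM -!ef -!eh !rmorphD.
by apply/forallP=> a; apply/forallP=> b; rewrite !permM -!ef -!eh !rmorphM.
Qed.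

Let elt (c : bool) v := if c then ln v else pt v.

Definition det1_assoc (g : {perm pg_elt}) (b : bool) (A : 'M[F]_3) (t : {perm F}) :=
  [&& field_aut t, \det A == 1
    & if b then correlation_mx g A t else collineation_mx g A t].

Lemma det1_assocP (g : {perm pg_elt}) :
  reflect (exists b A t, det1_assoc g b A t) (g \in coll_corr_det1).
Proof.
rewrite inE; apply: (iffP existsP) => [[A /existsP[t]]|[b [A [t]]]].
  case/and3P=> ht hA /orP[] h; [exists false|exists true]; exists A, t;
  by apply/and3P.
case/and3P=> ht hA h; exists A; apply/existsP; exists t.
by apply/and3P; split=> //; case: b h => ->; rewrite ?orbT.
Qed.

(* A acts on dual coordinates by its inverse transpose. *)
Let dual_mx (c : bool) (A : 'M[F]_3) := if c then (invmx A)^T else A.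

Lemma dual_nz c (A : 'M[F]_3) (t : {perm F}) (v : 'cV[F]_3) :
  field_aut t -> \det A == 1 -> v != 0 -> dual_mx c A *m map_mx t v != 0.
Proof.
move=> /field_autP[f ef] /eqP dA; apply: contraNneq => h.
have uA : dual_mx c A \in unitmx.
  by rewrite /dual_mx; case: c {h};
     rewrite ?unitmx_tr ?unitmx_inv unitmxE dA unitr1.
have : map_mx t v = 0 by rewrite -[LHS](mulKmx uA) h mulmx0.
rewrite -(eq_map_mx _ ef) => /eqP; by rewrite map_mx_eq0.
Qed.

Lemma det1_assoc_elt g b A t c (x : pg_elt) (v : 'cV[F]_3) :
  det1_assoc g b A t -> v != 0 -> val x = elt c v ->
  val (g x) = elt (c (+) b) (dual_mx c A *m map_mx t v).
Proof.
case/and3P=> ht hA hb.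
have hpt (y : pg_elt) (w : 'cV[F]_3) : w != 0 -> val y = pt w ->
    val (g y) = elt b (A *m map_mx t w).
  move=> nz /eqP e; apply/eqP; case: b hb => /andP[_ /forallP/(_ y)/forallP/(_ w)];
  by rewrite nz e.
case: c => [nz e|]; last exact: hpt.
set u := dual_mx _ A *m _.
have nzu : u != 0 by apply: dual_nz.
have uE (w : 'cV[F]_3) : (u^T *m (A *m map_mx t w) == 0) = (w \in val x).
  rewrite e inE /u /= trmx_mul trmxK -mulmxA mulKmx; last first.
    by rewrite unitmxE (eqP hA) unitr1.
  have [f ef] := field_autP ht; rewrite -!(eq_map_mx _ ef) matrix.map_trmx -map_mxM.
  by rewrite map_mx_eq0.
rewrite addTb; case: b hb hpt => /andP[/forallP hg _] hpt /=.
  pose z : pg_elt := Sub (pt u) (is_pg_pt nzu).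
  suff -> : x = (g^-1)%g z by rewrite permKV.
  apply: pg_elt_eq => w nzw; pose p : pg_elt := Sub (pt w) (is_pg_pt nzw).
  rewrite -uE -(pt_sub_pg ((g^-1)%g z) w); have /forallP/(_ p)/eqP := hg ((g^-1)%g z).
  have gp : val (g p) = ln (A *m map_mx t w) by apply: hpt.
  by rewrite permKV => <-; rewrite (_ : val z = pt u) // pt_sub_pg gp ln_sym inE.
pose z : pg_elt := Sub (ln u) (is_pg_ln nzu).
suff -> : x = (g^-1)%g z by rewrite permKV.
apply: pg_elt_eq => w nzw; pose p : pg_elt := Sub (pt w) (is_pg_pt nzw).
rewrite -uE -(pt_sub_pg ((g^-1)%g z) w); have /forallP/(_ ((g^-1)%g z))/eqP := hg p.
rewrite permKV => <-; rewrite (sub_pt_pg (v := A *m map_mx t w) (w := u)) //.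
exact: hpt.
Qed.

Lemma det1_assoc_incl g b A t (x y : pg_elt) : det1_assoc g b A t ->
  (val (g x) \subset val (g y)) =
  if b then val y \subset val x else val x \subset val y.
Proof.
by case/and3P=> _ _; case: b => /andP[/forallP/(_ x)/forallP/(_ y)/eqP].
Qed.

Lemma coll_corr_det1_group_set : group_set coll_corr_det1.
Proof.
apply/group_setP; split.
  apply/det1_assocP; exists false, 1%:M, 1%g; apply/and3P; split.
  - exact: field_aut1.
  - by rewrite det1.
  apply/andP; split; first by apply/forallP=> x; apply/forallP=> y; rewrite !perm1.
  apply/forallP=> x; apply/forallP=> v; apply/implyP=> /andP[_ /eqP e].
  rewrite perm1 mul1mx e; apply/eqP; congr pt.
  by apply/matrixP=> i j; rewrite mxE perm1.
move=> g h /det1_assocP[b [A [s gA]]] /det1_assocP[c [B [t hB]]].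
have [/field_autP[f ef] /eqP dA _] := and3P gA.
have [ht /eqP dB _] := and3P hB.
have [k ek] := field_autP ht.
pose C := dual_mx b B *m map_mx t A.
have dC : \det C = 1.
  rewrite det_mulmx -(eq_map_mx _ ek) det_map_mx dA rmorph1 mulr1.
  by rewrite /dual_mx; case: b {gA C}; rewrite ?det_tr ?det_inv dB ?invr1.
have hpt (x : pg_elt) (v : 'cV[F]_3) : v != 0 -> val x = pt v ->
    val ((g * h)%g x) = elt (b (+) c) (C *m map_mx (s * t)%g v).
  move=> nz e; rewrite permM.
  have fs : field_aut s by case/and3P: gA.
  have hA : \det A == 1 by apply/eqP.
  have nz' := dual_nz false fs hA nz.
  rewrite (det1_assoc_elt hB nz' (det1_assoc_elt (c := false) gA nz e)) addFb.
  congr (elt _ _); rewrite /C -mulmxA; congr (_ *m _).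
  rewrite -!(eq_map_mx _ ek) map_mxM; congr (_ *m _).
  by apply/matrixP=> i j; rewrite !mxE permM ek.
apply/det1_assocP; exists (b (+) c), C, (s * t)%g; apply/and3P; split.
- by apply: field_autM => //; case/and3P: gA.
- exact/eqP.
have inc x y := det1_assoc_incl ((g : {perm _}) x) (g y) hB.
have inc' x y := det1_assoc_incl x y gA.
case: (b) (c) hpt inc inc' => [] [] hpt inc inc'; apply/andP; split;
  (apply/forallP=> x; apply/forallP=> y;
   first [by rewrite !permM inc inc' |
     by apply/implyP=> /andP[nz /eqP e]; apply/eqP/hpt]).
Qed.

Canonical coll_corr_det1_group := Group coll_corr_det1_group_set.

End ProjectivePlane.

Section PointLineGeometry.

Variables (T : finType) (lines : {set {set T}}).

Definition geom_aut : {set {perm T}} :=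
  [set s : {perm T} | [forall L in lines, s @: L \in lines]].

Lemma geom_aut_group_set : group_set geom_aut.
Proof.
apply/group_setP; split.
  rewrite inE; apply/forall_inP=> L hL.
  by rewrite (eq_imset _ (@perm1 T)) imset_id.
move=> s t; rewrite !inE => /forall_inP hs /forall_inP ht.
apply/forall_inP=> L hL; rewrite (eq_imset _ (permM s t)).
by rewrite (imset_comp t s); apply/ht/hs.
Qed.

Canonical geom_aut_group := Group geom_aut_group_set.

End PointLineGeometry.

Section NearOctagon.

Variables (gT : finGroupType) (G : {group gT}).

Definition central_involution (x : gT) : bool :=
  [&& x \in G, #[x] == 2
    & [exists H : {group gT}, 2.-Sylow(G) H && (x \in 'C_G(H))]].

Definition O2_point := {x : gT | central_involution x}.

Definition O2_lines : {set {set O2_point}} :=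
  [set L : {set O2_point} | [exists x : O2_point, exists y : O2_point,
     [&& x != y, val x * val y == val y * val x,
         #|G : 'N_G(<<[set val x; val y]>>)| \in [:: 105; 420]%N
       & val @: L == [set val x; val y; val x * val y]]]].

End NearOctagon.

(* Main.v *)
(* Write an elation of PG(2,4) as 1 + p a^T, with centre p and axis a^T x = 0.
   These 315 elations form one class of odd size, so they are central
   involutions; conversely a Sylow 2-subgroup contains, up to conjugacy, the
   elations with a fixed centre, and these form a self-centralizing group.

   Distinct commuting elations share their centre or their axis.  If they share
   both, the four-group they generate has 105 conjugates.  If they share only the
   centre p, their axes satisfy a x b = l p, where l does not depend on the
   choice of coordinates (as k^3 = 1) and is preserved up to field automorphisms
   by the maps of determinant 1; there are 420 conjugates if l = 1 and 840
   otherwise.  This, and its dual, makes the lines explicit.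

   Automorphisms are determined by eight base points and the number of 3-walks in
   the collinearity graph.  If an automorphism fixes the first i base points, the
   walk counts leave as images of the next one only points of its orbit under
   the elements of G that fix the first i as well; and the walk counts to all
   eight base points separate the 315 points.  So every automorphism becomes the
   identity after conjugations by elements of G. *)

(* The group is given only up to isomorphism, so the plane has to disappear from the argument. All
   that it must supply is collected in the record [model], which isomorphisms preserve; from then on
   [G] is handled through the codes of its elations, and equalities of codes follow from equalities
   of group elements by injectivity. Composites and inverses of semilinear data are not computed:
   they are obtained as data of products and inverses in [G].

   Transitivity on the 315 elations keeps the checks small: pairs and four-groups are inspected only
   when they contain [x0]. There are 1, 4 or 8 four-groups of a given kind on [x0], and each
   contains three elations, whence the indices 315 * 1 / 3 = 105, 315 * 4 / 3 = 420 and 315 * 8 / 3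
   = 840.

   The orbit lengths 315, 8, 2, 4, 4 of the first five base points multiply to 80640 = 4 * 20160,
   the order of L_3(4):2^2. Five points thus already have trivial stabilizer in [G]; the other three
   only add walk counts, until these tell all points apart. *)
Require Import Defs.
From Stdlib Require Import Ring.
From HB Require Import structures.
From mathcomp Require Import all_boot all_order all_algebra.
From mathcomp Require Import all_fingroup all_solvable all_field.

Set Implicit Arguments.
Unset Strict Implicit.
Unset Printing Implicit Defensive.

(** * The field of four elements *)

(* (a, b) stands for a + b w, where w^2 = w + 1; the inverse of k is k^2. *)
Definition K := (bool * bool)%type.
Definition k0 : K := (false, false).
Definition k1 : K := (true, false).
Definition kw : K := (false, true).
Definition kw2 : K := (true, true).
Definition kadd (x y : K) : K :=
  let: (a, b) := x in let: (c, d) := y in (xorb a c, xorb b d).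
Definition kmul (x y : K) : K :=
  let: (a, b) := x in let: (c, d) := y in
  (xorb (a && c) (b && d), xorb (xorb (a && d) (b && c)) (b && d)).
Definition ksq (x : K) : K := let: (a, b) := x in (xorb a b, b).
Definition kopp (x : K) : K := x.
Definition keq (x y : K) : bool :=
  let: (a, b) := x in let: (c, d) := y in
  if a then c && (if b then d else ~~ d) else ~~ c && (if b then d else ~~ d).
Definition kbool (b : bool) : K := if b then k1 else k0.

Lemma K_ring : ring_theory k0 k1 kadd kmul kadd kopp eq.
Proof. by split; repeat (case; case=> [] []). Qed.

(** Coefficients in [bool] with [xorb] let [ring] compute modulo 2, so that it proves identities
    valid only in characteristic 2. *)
Lemma K_morph : ring_morph k0 k1 kadd kmul kadd kopp eq
  false true xorb andb xorb id Bool.eqb kbool.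
Proof. by split => //; do ?[case] => // [] []. Qed.

Ltac kcst t := match t with k0 => constr:(false) | k1 => constr:(true)
  | _ => constr:(InitialRing.NotConstant) end.
Add Ring K_Ring : K_ring (morphism K_morph, constants [kcst]).

Declare Scope k_scope.
Delimit Scope k_scope with k.
Bind Scope k_scope with K.
Infix "+" := kadd : k_scope.
Infix "*" := kmul : k_scope.

Arguments kadd : simpl never.
Arguments kmul : simpl never.

(** * Elations in coordinates *)

Definition vec := (K * K * K)%type.
Definition mat := (vec * vec * vec)%type.
(* (p, a) stands for the elation 1 + p a^T, also given by (k^-1 p, k a). *)
Definition code := (vec * vec)%type.

Definition v0 : vec := (k0, k0, k0).
Definition vadd (u v : vec) : vec :=
  let: (a, b, c) := u in let: (x, y, z) := v in (a + x, b + y, c + z)%k.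
Definition smul (k : K) (v : vec) : vec :=
  let: (x, y, z) := v in (k * x, k * y, k * z)%k.
Definition dot (u v : vec) : K :=
  let: (a, b, c) := u in let: (x, y, z) := v in (a * x + b * y + c * z)%k.
(** The vector product, without signs in characteristic 2: the line through two points, or the meet
    of two lines. *)
Definition cross (u v : vec) : vec :=
  let: (a, b, c) := u in let: (x, y, z) := v in
  (b * z + c * y, c * x + a * z, a * y + b * x)%k.
(** Nested conditionals here and below replace [&&], both of whose arguments would be computed under
    call-by-value evaluation. *)
Definition veq (u v : vec) : bool :=
  let: (a, b, c) := u in let: (x, y, z) := v in
  if keq a x then if keq b y then keq c z else false else false.
Definition frob (t : bool) (v : vec) : vec :=
  if t then let: (x, y, z) := v in (ksq x, ksq y, ksq z) else v.
Definition lead (v : vec) : K :=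
  let: (x, y, z) := v in
  if keq x k0 then if keq y k0 then z else y else x.

Definition mulv (A : mat) (v : vec) : vec :=
  let: (r, s, t) := A in (dot r v, dot s v, dot t v).
Definition kdet (A : mat) : K := let: (r, s, t) := A in dot r (cross s t).
(* If det A = 1, this is the inverse transpose of A. *)
Definition cof (A : mat) : mat :=
  let: (r, s, t) := A in (cross s t, cross t r, cross r s).

Definition ceq (x y : code) : bool :=
  let: (p, a) := x in let: (q, b) := y in if veq p q then veq a b else false.

Definition ks : seq K := [:: k1; kw; kw2].
Definition swapc (x : code) : code := (x.2, x.1).
Definition normalize (x : code) : code :=
  let: (p, a) := x in let k := lead p in (smul (ksq k) p, smul k a).
Definition flag (x : code) : bool :=
  let: (p, a) := x in
  if veq p v0 then false else if veq a v0 then false else keq (dot a p) k0.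
Definition valid (x : code) : bool :=
  if keq (lead x.1) k1 then flag x else false.

(** If [x] is 1 + p a^T then [y] is 1 + kl p a^T, so [k * l <> k1] excludes the elation [x]
    itself. *)
Definition sameFlag (x y : code) : bool :=
  has (fun k => if veq y.1 (smul k x.1) then
    has (fun l => if veq y.2 (smul l x.2) then ~~ keq (k * l)%k k1 else false) ks
    else false) ks.
(* Writing y as (p, b) with the coordinates p of the centre of x = (p, a), this
   says a x b = p. *)
Definition goodC (x y : code) : bool :=
  has (fun k => if veq y.1 (smul k x.1) then
    veq (smul k (cross x.2 y.2)) x.1 else false) ks.
Definition good (x y : code) : bool := goodC x y || goodC (swapc x) (swapc y).
Definition commuting (x y : code) : bool :=
  if keq (dot x.2 y.1) k0 then keq (dot y.2 x.1) k0 else false.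
Definition adj (x y : code) : bool := good x y || sameFlag x y.

Definition kall : seq K := [:: k0; k1; kw; kw2].
Definition vall : seq vec :=
  [seq (x, z) | x <- [seq (x, y) | x <- kall, y <- kall], z <- kall].
Definition allcodes : seq code :=
  [seq x <- [seq (p, a) | p <- [seq v <- vall | keq (lead v) k1], a <- vall] | valid x].

(* (A, t, b) stands for v |-> A v^t, with v^t the vector of squares if t is true,
   followed by the duality of the bases if b is true; [fmat d true] is the action
   on dual coordinates. *)
Definition data := (mat * bool * bool)%type.
Definition fmat (d : data) (c : bool) (v : vec) : vec :=
  let: (A, t, _) := d in mulv (if c then cof A else A) (frob t v).
Definition dact (d : data) (x : code) : code :=
  normalize (if d.2 then (fmat d true x.2, fmat d false x.1)
        else (fmat d false x.1, fmat d true x.2)).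
Definition ddet (d : data) : K := kdet d.1.1.
Definition e1 : vec := (k1, k0, k0).
Definition e2 : vec := (k0, k1, k0).
Definition e3 : vec := (k0, k0, k1).
Definition elat (x : code) : data :=
  let: (p, (a, b, c)) := x in
  let: (x, y, z) := p in
  ((vadd e1 (smul x (a, b, c)), vadd e2 (smul y (a, b, c)),
    vadd e3 (smul z (a, b, c))),
   false, false).

(** * Base points and transporting elements *)

Definition x0 : code := (e1, e3).
Definition x1 : code := (e1, e2).
Definition x2 : code := (e1, (k0, k1, kw)).
Definition x3 : code := (e2, e3).
Definition x4 : code := (e3, e2).
Definition vc (a b c : nat) : vec := (nth k0 kall a, nth k0 kall b, nth k0 kall c).
(* The last three points are fixed once the first five are; the first five have
   successive orbits of length 315, 8, 2, 4, 4. *)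
Definition base : seq code := [:: x0; x1; x2; x3; x4;
  (vc 1 3 2, vc 1 3 2); (vc 1 1 3, vc 1 1 0); (vc 1 3 0, vc 2 3 1)].

Definition layer (L : seq data) (s : seq code) : seq code :=
  flatten [seq [seq dact d x | d <- L] | x <- s].
Definition id_data : data := ((e1, e2, e3), false, false).
(* The lists below represent the cosets of a Borel subgroup in the two minimal
   parabolic subgroups: a product of three of them reaches every flag, and
   [torus] the three elations of the flag. *)
Definition parabolic1 : seq data :=
  id_data :: [seq (((k, k1, k0), e1, e3), false, false) | k <- kall].
Definition parabolic2 : seq data :=
  id_data :: [seq ((e1, (k0, k, k1), e2), false, false) | k <- kall].
Definition torus : seq data :=
  [seq ((e1, (k0, k, k0), (k0, k0, ksq k)), false, false) | k <- ks].
Definition stab_x0 : seq data :=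
  [seq ((e1, (k0, k1, k), e3), t, false) | k <- kall, t <- [:: false; true]] ++
  [seq ((e3, e2, (k1, k, k0)), t, true) | k <- kall, t <- [:: false; true]].

Definition cmem (x : code) (s : seq code) := has (ceq x) s.
Definition cells : seq code :=
  layer parabolic1 (layer parabolic2 (layer parabolic1 (layer torus [:: x0]))).
Definition check_trans : bool := all (fun x => cmem x cells) allcodes.

Definition neighbours x := [seq y <- allcodes | adj x y].
(** Walks x, u, v, z; the last step is taken backwards from [z], which is legitimate because [adj]
    is symmetric. *)
Definition walks3 x z := sumn [seq count (adj u) (neighbours z) | u <- neighbours x].

(* Otherwise simplification would enumerate the 315 codes. *)
Arguments allcodes : simpl never.
Arguments neighbours : simpl never.
Arguments walks3 : simpl never.
Arguments cells : simpl never.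

(** * Semilinear algebra over K *)

Lemma keqP : Equality.axiom keq.
Proof. by do 2!case=> [] [] []; constructor. Qed.

Lemma veqP : Equality.axiom veq.
Proof.
move=> [[a b] c] [[x y] z]; rewrite /veq.
case: keqP => [->|h]; last by constructor; case.
case: keqP => [->|h]; last by constructor; case.
by case: keqP => [->|h]; constructor=> //; case.
Qed.

Lemma ceqP : Equality.axiom ceq.
Proof.
move=> [p a] [q b]; rewrite /ceq.
case: veqP => [->|h]; last by constructor; case.
by case: veqP => [->|h]; constructor=> //; case.
Qed.

Lemma cmemE x s : cmem x s = (x \in s).
Proof.
by rewrite -has_pred1; apply: eq_has => y /=; apply/ceqP/eqP=> ->.
Qed.

Lemma kmul1 x : (k1 * x = x)%k. Proof. ring. Qed.
Lemma kmulC x y : (x * y = y * x)%k. Proof. ring. Qed.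
Lemma kmulA x y z : (x * (y * z) = x * y * z)%k. Proof. ring. Qed.

Lemma ksqE x : ksq x = (x * x)%k.
Proof. by case: x => [] [] []. Qed.

Lemma ksqM x y : ksq (x * y)%k = (ksq x * ksq y)%k.
Proof. by rewrite !ksqE; ring. Qed.

Lemma ksqD x y : ksq (x + y)%k = (ksq x + ksq y)%k.
Proof. by rewrite !ksqE; ring. Qed.

Lemma ksqK x : ksq (ksq x) = x.
Proof. by case: x => [] [] []. Qed.

Lemma kmulV x : x <> k0 -> (x * ksq x = k1)%k.
Proof. by case: x => [] [] []. Qed.

Lemma kmul_nz x y : x <> k0 -> y <> k0 -> (x * y)%k <> k0.
Proof. by case: x => [] [] []; case: y => [] [] []. Qed.

Lemma smulA k l v : smul k (smul l v) = smul (k * l)%k v.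
Proof. by case: v => [[x y] z] /=; congr (_, _, _); ring. Qed.

Lemma smul1 v : smul k1 v = v.
Proof. by case: v => [[x y] z] /=; congr (_, _, _); ring. Qed.

Lemma smulK k v : k <> k0 -> smul (ksq k) (smul k v) = v.
Proof. by move=> nz; rewrite smulA kmulC kmulV ?smul1. Qed.

Lemma smul_nz k v : k <> k0 -> v <> v0 -> smul k v <> v0.
Proof.
by move=> hk hv e; apply: hv; rewrite -(smulK v hk) e; case: k {hk e} => [] [] [].
Qed.

Lemma cross_smul k l u v : cross (smul k u) (smul l v) = smul (k * l)%k (cross u v).
Proof.
by case: u => [[a b] c]; case: v => [[x y] z] /=; congr (_, _, _); ring.
Qed.

Lemma dot_smul k l u v : dot (smul k u) (smul l v) = (k * l * dot u v)%k.
Proof. by case: u => [[a b] c]; case: v => [[x y] z] /=; ring. Qed.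

Lemma dotC u v : dot u v = dot v u.
Proof. by case: u => [[a b] c]; case: v => [[x y] z] /=; ring. Qed.

Lemma mulv_smul A k v : mulv A (smul k v) = smul k (mulv A v).
Proof.
case: A => [[[[a b] c] [[a' b'] c']] [[a'' b''] c'']]; case: v => [[x y] z] /=.
by congr (_, _, _); ring.
Qed.

Lemma cross_mulv A u v : cross (mulv A u) (mulv A v) = mulv (cof A) (cross u v).
Proof.
case: A => [[[[a b] c] [[a' b'] c']] [[a'' b''] c'']].
case: u => [[p q] r]; case: v => [[x y] z] /=.
by congr (_, _, _); ring.
Qed.

(** For every 3 x 3 matrix, cof (cof A) = (det A) A; inserting det A = 1 as a factor turns the claim
    into this polynomial identity. *)
Lemma cof_cof A : kdet A = k1 -> cof (cof A) = A.
Proof.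
case: A => [[[[a b] c] [[a' b'] c']] [[a'' b''] c'']] /= d.
congr (_, _, _, (_, _, _), (_, _, _));
  rewrite -[RHS]kmul1 -d; ring.
Qed.

Lemma dot_cof A u v : kdet A = k1 -> dot (mulv (cof A) u) (mulv A v) = dot u v.
Proof.
move=> d; rewrite -[RHS]kmul1 -d.
case: A {d} => [[[[a b] c] [[a' b'] c']] [[a'' b''] c'']].
by case: u => [[p q] r]; case: v => [[x y] z] /=; ring.
Qed.

Definition kfrob (t : bool) (x : K) := if t then ksq x else x.

Lemma kfrob_nz t x : x <> k0 -> kfrob t x <> k0.
Proof. by case: t; case: x => [] [] []. Qed.

Lemma kfrobM t x y : kfrob t (x * y)%k = (kfrob t x * kfrob t y)%k.
Proof. by case: t; rewrite //= ksqM. Qed.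

Lemma frob_smul t k v : frob t (smul k v) = smul (kfrob t k) (frob t v).
Proof. by case: t => //; case: v => [[x y] z] /=; rewrite !ksqM. Qed.

Lemma frob_cross t u v : cross (frob t u) (frob t v) = frob t (cross u v).
Proof.
case: t => //; case: u => [[a b] c]; case: v => [[x y] z] /=.
by rewrite !(ksqM, ksqD).
Qed.

Lemma frob_dot t u v : dot (frob t u) (frob t v) = kfrob t (dot u v).
Proof.
case: t => //; case: u => [[a b] c]; case: v => [[x y] z] /=.
by rewrite !(ksqM, ksqD).
Qed.

Lemma dot_nondeg v : v <> v0 -> exists u, dot u v = k1.
Proof.
case: v => [[x y] z] nz.
have [hx|hx] := keqP x k0; last first.
  by exists (ksq x, k0, k0) => /=; rewrite -(kmulV hx); ring.
have [hy|hy] := keqP y k0; last first.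
  by exists (k0, ksq y, k0) => /=; rewrite -(kmulV hy); ring.
have [hz|hz] := keqP z k0; last first.
  by exists (k0, k0, ksq z) => /=; rewrite -(kmulV hz); ring.
by case: nz; rewrite hx hy hz.
Qed.

(** * Invariance of the relations between elations under semilinear maps and dualities *)

Definition scale (k : K) (x : code) : code := (smul (ksq k) x.1, smul k x.2).

Lemma normalizeE x : normalize x = scale (lead x.1) x.
Proof. by case: x. Qed.

Lemma swapc_scale k x : swapc (scale k x) = scale (ksq k) (swapc x).
Proof. by case: x => p a; rewrite /swapc /scale /= ksqK. Qed.

Section Data.
Variable d : data.
Hypothesis d1 : ddet d = k1.
Let t := d.1.2.

Lemma fmat_smul c k v : fmat d c (smul k v) = smul (kfrob t k) (fmat d c v).
Proof. by rewrite /t; case: d => [[A s] b] /=; rewrite frob_smul mulv_smul. Qed.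

(** The determinant condition enters here: (A u) x (A v) = cof A (u x v), and for dual coordinates
    cof (cof A) = A. The condition a x b = p is invariant for this reason. *)
Lemma fmat_cross c u v : cross (fmat d c u) (fmat d c v) = fmat d (~~ c) (cross u v).
Proof.
move: d1; case: d => [[A s] b] /= A1; rewrite /ddet /= in A1.
by case: c; rewrite /= cross_mulv ?cof_cof // frob_cross.
Qed.

Lemma fmat_dot c u v : dot (fmat d (~~ c) u) (fmat d c v) = kfrob t (dot u v).
Proof.
move: d1; rewrite /t; case: d => [[A s] b] /= A1; rewrite /ddet /= in A1.
by case: c => /=; rewrite -frob_dot ?dot_cof // dotC dot_cof // dotC.
Qed.

Lemma fmat_nz c v : v <> v0 -> fmat d c v <> v0.
Proof.
move=> /dot_nondeg[u e] f0; have := fmat_dot c u v.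
rewrite f0 e; case: (fmat _ _ u) => [[x y] z] /=.
rewrite (_ : (_ + _)%k = k0); last by ring.
by rewrite /t; case: d => [[A []] b].
Qed.

Definition raw (x : code) : code :=
  if d.2 then (fmat d true x.2, fmat d false x.1)
  else (fmat d false x.1, fmat d true x.2).

Lemma actE x : dact d x = scale (lead (raw x).1) (raw x).
Proof. by rewrite -normalizeE. Qed.

End Data.

Lemma lead_nz v : v <> v0 -> lead v <> k0.
Proof.
case: v => [[x y] z] /=; case: keqP => [->|//]; case: keqP => [->|//].
by move=> h e; apply: h; rewrite e.
Qed.

Lemma lead_smul k v : k <> k0 -> lead (smul k v) = (k * lead v)%k.
Proof.
case: v => [[x y] z] /=; case: k => [] [] [] //; case: x => [] [] [] //;
 case: y => [] [] [] //.
Qed.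

Lemma flagP x : reflect [/\ x.1 <> v0, x.2 <> v0 & dot x.2 x.1 = k0] (flag x).
Proof.
case: x => p a /=; case: veqP => [->|hp]; first by constructor; case.
case: veqP => [->|ha]; first by constructor; case.
by case: keqP => h; constructor; [split | case].
Qed.

Lemma validP x : reflect (lead x.1 = k1 /\ flag x) (valid x).
Proof.
rewrite /valid; case: keqP => [->|h]; last by constructor; case.
by case: (flag x); constructor; [ | case].
Qed.

Lemma flag_scale k x : k <> k0 -> flag x -> flag (scale k x).
Proof.
move=> hk /flagP[hp ha h]; apply/flagP; split; first exact/smul_nz/hp/(@kfrob_nz true).
  exact: smul_nz.
by rewrite /= dot_smul h; ring.
Qed.

Lemma valid_normalize x : flag x -> valid (normalize x).
Proof.
move=> h; have /flagP[hp _ _] := h; have hl := lead_nz hp.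
apply/validP; split; last by rewrite normalizeE; apply: flag_scale.
rewrite normalizeE /scale /= lead_smul; last exact: (@kfrob_nz true).
by rewrite kmulC kmulV.
Qed.

Lemma raw_flag d x : ddet d = k1 -> flag x -> flag (raw d x).
Proof.
move=> d1 /flagP[hp ha h]; apply/flagP; rewrite /raw; case: ifP => _ /=.
  split; [exact: fmat_nz|exact: fmat_nz|].
  rewrite -[false]/(~~ true) fmat_dot // dotC h.
  by rewrite /kfrob; case: ifP.
split; [exact: fmat_nz|exact: fmat_nz|].
by rewrite -[true]/(~~ false) fmat_dot // h /kfrob; case: ifP.
Qed.

Lemma valid_flag x : valid x -> flag x. Proof. by case/validP. Qed.

Lemma valid_act d x : ddet d = k1 -> valid x -> valid (dact d x).
Proof. by move=> d1 /valid_flag h; apply: valid_normalize; apply: raw_flag. Qed.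

Lemma hasksP (P : pred K) : reflect (exists2 k, k <> k0 & P k) (has P ks).
Proof.
apply: (iffP hasP) => -[k hk Pk]; exists k => //.
  by move: hk; rewrite !inE => /or3P[] /eqP->.
by case: k hk {Pk} => [] [] [].
Qed.

Lemma sameFlagP x y : reflect (exists k l, [/\ k <> k0, l <> k0, y.1 = smul k x.1,
  y.2 = smul l x.2 & (k * l)%k <> k1]) (sameFlag x y).
Proof.
apply: (iffP (hasksP _)) => [[k hk]|[k [l [hk hl e1 e2 h]]]].
  case: veqP => // e1 /hasksP[l hl]; case: veqP => // e2 /keqP h.
  by exists k, l.
exists k => //; case: veqP => // _; apply/hasksP; exists l => //.
by case: veqP => // _; apply/keqP.
Qed.

Lemma goodCP x y : reflect (exists k, [/\ k <> k0, y.1 = smul k x.1 &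
  x.1 = smul k (cross x.2 y.2)]) (goodC x y).
Proof.
apply: (iffP (hasksP _)) => [[k hk]|[k [hk e1 e2]]].
  by case: veqP => // e1 /veqP e2; exists k.
by exists k => //; case: veqP => // _; apply/veqP.
Qed.

Lemma sameFlag_swapc x y : sameFlag x y -> sameFlag (swapc x) (swapc y).
Proof.
case/sameFlagP=> k [l [hk hl e1 e2 h]]; apply/sameFlagP; exists l, k.
by split=> //; rewrite kmulC.
Qed.

Lemma sameFlag_scale m n x y : m <> k0 -> n <> k0 ->
  sameFlag x y -> sameFlag (scale m x) (scale n y).
Proof.
move=> hm hn /sameFlagP[k [l [hk hl e1 e2 h]]]; apply/sameFlagP.
exists (k * ksq n * m)%k, (l * n * ksq m)%k.
have hm2 := @kfrob_nz true _ hm; have hn2 := @kfrob_nz true _ hn.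
split; rewrite /scale /=.
- by do !apply: kmul_nz.
- by do !apply: kmul_nz.
- rewrite e1 !smulA -kmulA kmulV //; congr smul; ring.
- rewrite e2 !smulA; rewrite -!kmulA [(ksq m * m)%k]kmulC kmulV //; congr smul; ring.
rewrite (_ : k * ksq n * m * _ = k * l * (n * ksq n) * (m * ksq m))%k; last by ring.
by rewrite !kmulV // kmulC kmul1 kmulC kmul1.
Qed.

Lemma goodC_scale m n x y : m <> k0 -> n <> k0 ->
  goodC x y -> goodC (scale m x) (scale n y).
Proof.
move=> hm hn /goodCP[k [hk e1 e2]]; apply/goodCP.
(* The new ratio of the centres: n^2 k p = (k n^2 m) (m^2 p), because m^3 = 1. *)
exists (k * ksq n * m)%k.
have hm2 := @kfrob_nz true _ hm; have hn2 := @kfrob_nz true _ hn.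
split; rewrite /scale /=.
- by do !apply: kmul_nz.
- rewrite e1 !smulA -kmulA kmulV //; congr smul; ring.
rewrite {1}e2 cross_smul !smulA; congr smul.
rewrite (_ : (k * _ * _ * _ = k * (m * m) * (n * ksq n)))%k; last by ring.
by rewrite kmulV // -ksqE; ring.
Qed.

Lemma good_scale m n x y : m <> k0 -> n <> k0 ->
  good x y -> good (scale m x) (scale n y).
Proof.
move=> hm hn /orP[] h; apply/orP; first by left; apply: goodC_scale.
by right; rewrite !swapc_scale; apply: goodC_scale => //; apply: (@kfrob_nz true).
Qed.

Lemma sameFlag_raw d x y : ddet d = k1 -> sameFlag x y -> sameFlag (raw d x) (raw d y).
Proof.
move=> d1; have H a b a' b' : sameFlag (a, b) (a', b') ->
    sameFlag (fmat d false a, fmat d true b) (fmat d false a', fmat d true b').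
  case/sameFlagP=> /= k [l [hk hl -> -> h]]; apply/sameFlagP.
  exists (kfrob d.1.2 k), (kfrob d.1.2 l); rewrite !fmat_smul /=; split=> //.
  - exact: kfrob_nz.
  - exact: kfrob_nz.
  by rewrite -kfrobM /kfrob; case: ifP => // _ e; apply: h; rewrite -[LHS]ksqK e.
rewrite /raw; case: x y => a b [a' b'] /H; case: ifP => //= _.
exact: sameFlag_swapc.
Qed.

(** The second conclusion is meant for swapped codes, whose first component holds dual coordinates;
    pairs with a common axis are reduced to it. *)
Lemma goodC_raw d x y : ddet d = k1 -> goodC x y ->
   goodC (fmat d false x.1, fmat d true x.2) (fmat d false y.1, fmat d true y.2)
 /\ goodC (fmat d true x.1, fmat d false x.2) (fmat d true y.1, fmat d false y.2).
Proof.
move=> d1; case: x y => p a [q b] /goodCP[/= k [hk e1 e2]].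
have hk' := @kfrob_nz d.1.2 _ hk.
split; apply/goodCP; exists (kfrob d.1.2 k); split=> //=.
- by rewrite e1 fmat_smul.
- by rewrite {1}e2 fmat_smul // fmat_cross.
- by rewrite e1 fmat_smul.
by rewrite {1}e2 fmat_smul // fmat_cross.
Qed.

Lemma good_raw d x y : ddet d = k1 -> good x y -> good (raw d x) (raw d y).
Proof.
move=> d1 /orP[] /(goodC_raw d1)[h1 h2]; rewrite /good /raw; case: ifP => _ /=;
 rewrite /swapc /= in h1 h2 *; by rewrite ?h1 ?h2 ?orbT.
Qed.

Lemma commuting_scale m n x y :
  commuting x y -> commuting (scale m x) (scale n y).
Proof.
rewrite /commuting; case: keqP => // h1 /keqP h2; rewrite /scale /= !dot_smul h1 h2.
rewrite (_ : (_ * k0)%k = k0); last by ring.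
by rewrite (_ : (_ * k0)%k = k0) //; ring.
Qed.

Lemma commuting_raw d x y : ddet d = k1 -> commuting x y -> commuting (raw d x) (raw d y).
Proof.
move=> d1; rewrite /commuting; case: keqP => // h1 /keqP h2; rewrite /raw.
have F c u v : dot u v = k0 -> dot (fmat d (~~ c) u) (fmat d c v) = k0.
  by move=> e; rewrite fmat_dot // e /kfrob; case: ifP.
have F0 u v : dot u v = k0 -> dot (fmat d true u) (fmat d false v) = k0.
  exact: (F false).
have F1 u v : dot u v = k0 -> dot (fmat d false u) (fmat d true v) = k0.
  exact: (F true).
case: (d.2) => /=; last first.
  by rewrite !F0.
by rewrite !F1 // dotC.
Qed.

Lemma raw_lead d x : ddet d = k1 -> flag x -> lead (raw d x).1 <> k0.
Proof. by move=> d1 /(raw_flag d1)/flagP[h _ _]; apply: lead_nz. Qed.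

Section ActInv.
Variables (d : data) (x y : code).
Hypotheses (d1 : ddet d = k1) (fx : flag x) (fy : flag y).

Lemma sameFlag_act : sameFlag x y -> sameFlag (dact d x) (dact d y).
Proof.
by move=> h; rewrite !actE; apply: sameFlag_scale (sameFlag_raw d1 h); apply: raw_lead.
Qed.
Lemma good_act : good x y -> good (dact d x) (dact d y).
Proof.
by move=> h; rewrite !actE; apply: good_scale (good_raw d1 h); apply: raw_lead.
Qed.
Lemma commuting_act : commuting x y -> commuting (dact d x) (dact d y).
Proof. by move=> h; rewrite !actE; apply: commuting_scale; apply: commuting_raw. Qed.
End ActInv.

(** * Enumeration of the elations and their action on points and lines *)

Lemma mem_vall v : v \in vall.
Proof. by case: v => [[[[] []] [[] []]] [[] []]]. Qed.

Lemma mem_allcodes x : (x \in allcodes) = valid x.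
Proof.
rewrite /allcodes mem_filter; case: (boolP (valid x)) => // vx; rewrite andTb.
have /validP[h _] := vx; case: x vx h => p a _ h.
apply: (allpairs_f (fun p a => (p, a))); last exact: mem_vall.
by rewrite mem_filter mem_vall andbT; apply/keqP.
Qed.

Lemma uniq_allcodes : uniq allcodes.
Proof. by vm_compute. Qed.

Lemma size_allcodes : size allcodes = 315.
Proof. by vm_compute. Qed.

Lemma cross_self k u : cross u (smul k u) = v0.
Proof. by case: u => [[a b] c] /=; congr (_, _, _); ring. Qed.

Lemma cross0_smul u v : u <> v0 -> v <> v0 -> cross u v = v0 ->
  exists2 k, k <> k0 & v = smul k u.
Proof.
move=> hu hv h; suff [k e] : exists k, v = smul k u.
  exists k => // k0_; apply: hv; rewrite e k0_.
  by case: u {hu h e} => [[a b] c] /=; congr (_, _, _); ring.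
have [w e] := dot_nondeg hu.
(* When u x v = 0, one has (w . u) v = (w . v) u for every w, and here w . u = 1. *)
exists (dot w v); rewrite -[LHS]smul1 -e.
case: u h {hu e} => [[a b] c]; case: v {hv} => [[x y] z];
  case: w => [[p q] r] /= [E1 E2 E3].
have D (m n : K) : (m + n)%k = k0 -> m = n by case: m => [[] []]; case: n => [[] []].
have {}E1 : (b * z = c * y)%k by apply: D.
have {}E2 : (c * x = a * z)%k by apply: D.
have {}E3 : (a * y = b * x)%k by apply: D.
congr (_, _, _).
- rewrite (_ : _ * x = p * a * x + q * (b * x) + r * (c * x))%k; last by ring.
  by rewrite -E3 E2; ring.
- rewrite (_ : _ * y = p * (a * y) + q * b * y + r * (c * y))%k; last by ring.
  by rewrite E3 -E1; ring.
rewrite (_ : _ * z = p * (a * z) + q * (b * z) + r * c * z)%k; last by ring.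
by rewrite -E2 E1; ring.
Qed.

(** In characteristic 2 the vectors (b, a, 0), (c, 0, a) and (0, c, b) are perpendicular to u = (a,
    b, c), and their products with v are the coordinates of u x v. The same vectors span the
    perpendicular space in the next lemma. *)
Lemma dot_perp_cross u v : (forall x, dot u x = k0 -> dot v x = k0) -> cross u v = v0.
Proof.
case: u => [[a b] c]; case: v => [[x y] z] h.
have := h (b, a, k0); have := h (c, k0, a); have := h (k0, c, b).
rewrite /= => h1 h2 h3; rewrite /v0; congr (_, _, _).
- by rewrite -h1; ring.
- by rewrite -h2; ring.
by rewrite -h3; ring.
Qed.

Lemma perp_not_collinear v : v <> v0 ->
  exists x y, [/\ dot v x = k0, dot v y = k0 & cross x y <> v0].
Proof.
case: v => [[a b] c] nz.
have H1 : dot (a, b, c) (b, a, k0) = k0 by rewrite /=; ring.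
have H2 : dot (a, b, c) (c, k0, a) = k0 by rewrite /=; ring.
have H3 : dot (a, b, c) (k0, c, b) = k0 by rewrite /=; ring.
have sq0 (m : K) : (m * m)%k = k0 -> m = k0 by case: m => [[] []].
have [a0|a0] := keqP a k0; last first.
  exists (b, a, k0), (c, k0, a); split=> // -[e _ _]; apply: a0; apply: sq0.
  by rewrite -e; ring.
have [b0|b0] := keqP b k0; last first.
  exists (b, a, k0), (k0, c, b); split=> // -[_ e _]; apply: b0; apply: sq0.
  by rewrite -e; ring.
have [c0|c0] := keqP c k0; last first.
  exists (c, k0, a), (k0, c, b); split=> // -[_ _ e]; apply: c0; apply: sq0.
  by rewrite -e; ring.
by case: nz; rewrite a0 b0 c0.
Qed.

(* The elation 1 + p a^T, acting on coordinates or on dual coordinates. *)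
Definition vtrans (x : code) (c : bool) (v : vec) : vec :=
  if c then vadd v (smul (dot x.1 v) x.2) else vadd v (smul (dot x.2 v) x.1).

(** det (1 + p a^T) = 1 + a . p. *)
Lemma elat_det x : dot x.2 x.1 = k0 -> ddet (elat x) = k1.
Proof.
case: x => [[[p q] r] [[a b] c]] /= h.
transitivity (k1 + (a * p + b * q + c * r))%k; last by rewrite h; ring.
by rewrite /ddet /=; ring.
Qed.

(** On dual coordinates this says that the inverse transpose of 1 + p a^T is 1 + a p^T; the entries
    of the cofactor matrix differ from these by multiples of a . p = 0. *)
Lemma fmat_elat x c v : dot x.2 x.1 = k0 -> fmat (elat x) c v = vtrans x c v.
Proof.
case: x => [[[p q] r] [[a b] c']] /= h; case: v => [[x y] z]; rewrite /vtrans.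
case: c => /=; last by congr (_, _, _); ring.
have E m n k : m = (n + (a * p + b * q + c' * r) * k)%k -> m = n.
  by move=> ->; rewrite h; ring.
by congr (_, _, _); [apply: (E _ _ x) | apply: (E _ _ y) | apply: (E _ _ z)]; ring.
Qed.

Lemma fmatD d c u v : fmat d c (vadd u v) = vadd (fmat d c u) (fmat d c v).
Proof.
case: d => [[A t] b] /=.
have -> : frob t (vadd u v) = vadd (frob t u) (frob t v).
  by case: t => //; case: u => [[x y] z]; case: v => [[x' y'] z'] /=; rewrite !ksqD.
case: (if c then _ else _) => [[[[? ?] ?] [[? ?] ?]] [[? ?] ?]].
case: (frob t u) => [[x y] z]; case: (frob t v) => [[x' y'] z'] /=.
by congr (_, _, _); ring.
Qed.

(** Conjugating 1 + p a^T moves its centre and axis, and a duality interchanges them. The formula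
    for [e x ^ g] in the group comes from this equivariance. *)
Lemma fmat_vtrans d x c v : ddet d = k1 ->
  fmat d c (vtrans x c v) = vtrans (raw d x) (c (+) d.2) (fmat d c v).
Proof.
move=> d1; have F0 u y : dot (fmat d true u) (fmat d false y) = kfrob d.1.2 (dot u y).
  exact: (fmat_dot d1 false).
have F1 u y : dot (fmat d false u) (fmat d true y) = kfrob d.1.2 (dot u y).
  exact: (fmat_dot d1 true).
rewrite /vtrans /raw; case: (d.2); case: c => /=;
 by rewrite fmatD fmat_smul ?F0 ?F1.
Qed.

Lemma vtrans_scale k x c v : k <> k0 -> vtrans (scale k x) c v = vtrans x c v.
Proof.
move=> hk; have E a p : smul (dot (smul (ksq k) a) v) (smul k p) = smul (dot a v) p.
  rewrite smulA -{1}[v]smul1 dot_smul; congr smul.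
  rewrite (_ : ksq k * k1 * dot a v * k = k * ksq k * dot a v)%k; last by ring.
  by rewrite kmulV // kmul1.
have E' a p : smul (dot (smul k a) v) (smul (ksq k) p) = smul (dot a v) p.
  rewrite smulA -{1}[v]smul1 dot_smul; congr smul.
  rewrite (_ : k * k1 * dot a v * ksq k = k * ksq k * dot a v)%k; last by ring.
  by rewrite kmulV // kmul1.
by rewrite /vtrans /scale /= E E'.
Qed.

Lemma fmat_vtrans_act d x c v : ddet d = k1 -> flag x ->
  fmat d c (vtrans x c v) = vtrans (dact d x) (c (+) d.2) (fmat d c v).
Proof. by move=> d1 fx; rewrite fmat_vtrans // actE vtrans_scale //; apply: raw_lead. Qed.

Lemma cross_diag u : cross u u = v0.
Proof. by rewrite -{2}[u]smul1 cross_self. Qed.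

Lemma cross_swap u v : cross u v = cross v u.
Proof. by case: u => [[a b] c]; case: v => [[x y] z] /=; congr (_, _, _); ring. Qed.

Lemma kmul0 k : (k * k0 = k0)%k. Proof. ring. Qed.
Lemma smul0 k : smul k v0 = v0. Proof. by rewrite /smul /v0 kmul0. Qed.
Lemma smul0v u : smul k0 u = v0.
Proof. by case: u => [[a b] c] /=; rewrite ![(k0 * _)%k]kmulC !kmul0. Qed.

Lemma fmat0 d c : fmat d c v0 = v0.
Proof.
case: d => [[A t] b]; rewrite /= (_ : frob t v0 = smul k0 v0); last by case: t.
by rewrite mulv_smul smul0v.
Qed.

Lemma fmat_cross0 d c u v : ddet d = k1 ->
  veq (cross (fmat d c u) (fmat d c v)) v0 = veq (cross u v) v0.
Proof.
move=> d1; rewrite fmat_cross //.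
have [->|nz] := veqP (cross u v); first by rewrite fmat0; apply/veqP.
by apply/negbTE/negP=> /veqP; apply: fmat_nz.
Qed.

(** Inclusion of subspaces in coordinates, with [true] for lines: elements of one type are included
    only if equal, and a line never lies in a point. *)
Definition incident (c : bool) (u : vec) (c' : bool) (v : vec) : bool :=
  if c == c' then veq (cross u v) v0 else (~~ c) && keq (dot v u) k0.

Lemma incident_fmat d c u c' v : ddet d = k1 ->
  incident (c (+) d.2) (fmat d c u) (c' (+) d.2) (fmat d c' v) =
  if d.2 then incident c' v c u else incident c u c' v.
Proof.
move=> d1; have F0 x y : keq (dot (fmat d true x) (fmat d false y)) k0 = keq (dot x y) k0.
  rewrite (fmat_dot d1 false) /kfrob; case: ifP => // _.
  by case: (dot x y) => [[] []].
have F1 x y : keq (dot (fmat d false x) (fmat d true y)) k0 = keq (dot y x) k0.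
  by rewrite dotC F0.
rewrite /incident; case: (d.2); case: c; case: c' => //=;
  rewrite ?fmat_cross0 ?F0 ?F1 // ?[cross v u]cross_swap //.
Qed.

Lemma dot_vadd u v w : dot (vadd u v) w = kadd (dot u w) (dot v w).
Proof.
by case: u => [[a b] c]; case: v => [[x y] z]; case: w => [[x' y'] z'] /=; ring.
Qed.

Lemma ksq_nz k : k <> k0 -> ksq k <> k0.
Proof. by case: k => [[] []]. Qed.

Lemma sameFlag_sym x y : sameFlag x y -> sameFlag y x.
Proof.
case/sameFlagP=> k [l [hk hl e1 e2 h]]; apply/sameFlagP; exists (ksq k), (ksq l).
split; [exact: ksq_nz|exact: ksq_nz|by rewrite e1 smulK|by rewrite e2 smulK|].
by rewrite -ksqM => e; apply: h; rewrite -[LHS]ksqK e.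
Qed.

Lemma goodC_sym x y : goodC x y -> goodC y x.
Proof.
case/goodCP=> k [hk e1 e2]; apply/goodCP; exists (ksq k).
split; [exact: ksq_nz|by rewrite e1 smulK|].
rewrite e1 e2 cross_swap !smulA ?kmulA -?ksqE //; congr smul.
Qed.

Lemma adj_sym x y : adj x y = adj y x.
Proof.
apply/idP/idP=> /orP[/orP[]|] h; apply/orP; rewrite /good ?(goodC_sym h) ?orbT; by
 [left|left|right; apply: sameFlag_sym].
Qed.

Lemma fmat_id_data c v : fmat id_data c v = v.
Proof. by case: c; case: v => [[x y] z] /=; congr (_, _, _); ring. Qed.

Lemma act_id_data x : valid x -> dact id_data x = x.
Proof.
case: x => p a /validP[lp _]; rewrite actE /raw [id_data.2]/= !fmat_id_data /scale.
by rewrite [X in lead X]/= lp /= !smul1.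
Qed.

Lemma dot_vadd_smul a v k p : dot a p = k0 -> dot a (vadd v (smul k p)) = dot a v.
Proof.
move=> h; transitivity (dot a v + k * dot a p)%k; last by rewrite h; ring.
by case: a {h} => [[a b] c]; case: v => [[x y] z]; case: p => [[p q] r] /=; ring.
Qed.

Lemma vtrans_vadd p a b c v : dot a p = k0 -> dot b p = k0 ->
  vtrans (p, b) c (vtrans (p, a) c v) = vtrans (p, vadd a b) c v.
Proof.
move=> ha hb; rewrite /vtrans; case: c => /=.
  rewrite dot_vadd_smul; last by rewrite dotC.
  case: (dot p v) => m n; move: (m, n) => k.
  case: a {ha} => [[a a'] a'']; case: b {hb} => [[b b'] b'']; case: v => [[x y] z] /=.
  by congr (_, _, _); ring.
rewrite dot_vadd_smul // dot_vadd; move: (dot a v) (dot b v) => k l.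
by case: p {ha hb} => [[p q] r]; case: v => [[x y] z] /=; congr (_, _, _); ring.
Qed.

(** * Automorphisms of the collinearity graph *)

Record isauto (s t : code -> code) : Prop := IsAuto {
  auto_valid : forall x, valid x -> valid (s x);
  auto_validV : forall x, valid x -> valid (t x);
  autoK : forall x, valid x -> t (s x) = x;
  autoVK : forall x, valid x -> s (t x) = x;
  auto_adj : forall x y, valid x -> valid y -> adj (s x) (s y) = adj x y }.

Lemma mem_neighbours x y : (y \in neighbours x) = adj x y && valid y.
Proof. by rewrite mem_filter mem_allcodes. Qed.

Lemma uniq_neighbours x : uniq (neighbours x).
Proof. exact: filter_uniq uniq_allcodes. Qed.

Lemma perm_neighbours s t x : isauto s t -> valid x ->
  perm_eq (neighbours (s x)) (map s (neighbours x)).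
Proof.
case=> vs vt sK tK sadj vx; apply: uniq_perm; first exact: uniq_neighbours.
  rewrite map_inj_in_uniq; [exact: uniq_neighbours|move=> u v].
  rewrite !mem_neighbours => /andP[_ vu] /andP[_ vv] e.
  by rewrite -(sK _ vu) e sK.
move=> u; rewrite mem_neighbours; apply/andP/mapP => [[au vu]|[v]].
  exists (t u); last by rewrite tK.
  by rewrite mem_neighbours vt // andbT -sadj ?tK //; apply: vt.
by rewrite mem_neighbours => /andP[av vv] ->; rewrite sadj // av vs.
Qed.

Lemma walks3_auto s t x z : isauto s t -> valid x -> valid z ->
  walks3 (s x) (s z) = walks3 x z.
Proof.
move=> a vx vz; rewrite /walks3.
have -> : sumn [seq count (adj u) (neighbours (s z)) | u <- neighbours (s x)] =
          sumn [seq count (adj u) (neighbours (s z)) | u <- map s (neighbours x)].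
  by apply: perm_sumn; apply: perm_map; apply: perm_neighbours a vx.
rewrite -map_comp; congr sumn; apply/eq_in_map => u.
rewrite mem_neighbours => /andP[_ vu] /=.
have /seq.permP-> := perm_neighbours a vz.
rewrite count_map; apply: eq_in_count => v.
by rewrite mem_neighbours => /andP[_ vv] /=; apply: auto_adj a _ _ vu vv.
Qed.

Definition signature z := [seq walks3 b z | b <- base].

Definition walks n m := sumn [seq count (adj u) m | u <- n].
(** The table of signatures, arranged so that each neighbourhood is listed once rather than once for
    every count. [check_rigid] takes the table as an argument in order to share it between the
    levels. *)
Definition rows : seq (code * seq nat) :=
  let nbb := [seq neighbours b | b <- base] in
  [seq let m := neighbours z in (z, [seq walks n m | n <- nbb]) | z <- allcodes].
Arguments rows : simpl never.
Arguments signature : simpl never.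

Definition seqn_eq (s t : seq nat) := all2 eqn s t.
Lemma rowsE : rows = [seq (z, signature z) | z <- allcodes].
Proof. by apply: eq_map => z; rewrite /signature -map_comp. Qed.

Definition center_moves : seq data := [seq elat (e1, (k0, k, l)) | k <- kall, l <- kall].
(* Among these, [check_level] finds elements that fix the base points 0, ..., i and
   transport each admissible image of the base point i + 1 to it. *)
Definition moves i := nth [:: id_data] [:: stab_x0; stab_x0; center_moves; center_moves] i.

Definition check_level (rs : seq (code * seq nat)) i : bool :=
  let b := nth x0 base i.+1 in
  let c := take i.+1 base in
  let sb := flatten [seq take i.+1 r.2 | r <- rs & ceq r.1 b] in
  all (fun r => if seqn_eq (take i.+1 r.2) sb
    then has (fun d => if ceq (dact d r.1) b then all (fun y => ceq (dact d y) y) c else false)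
      (moves i)
    else true) rs.
Definition check_rigid (rs : seq (code * seq nat)) : bool :=
  all (check_level rs) (iota 0 7) &&
  all (fun r => all (fun r' => if seqn_eq r.2 r'.2 then ceq r.1 r'.1 else true) rs) rs.

(** * Commuting pairs of elations *)

Inductive kind := KFlag | KGood | KBad.
Definition bad (x y : code) : bool :=
  if commuting x y then ~~ adj x y && ~~ ceq x y else false.
Definition krel (k : kind) : code -> code -> bool :=
  match k with KFlag => sameFlag | KGood => good | KBad => bad end.
Definition kinds := [:: KFlag; KGood; KBad].
(** For commuting elations the product is 1 + p a^T + q b^T. Centres are normalized, so a common
    centre means equal first components; otherwise the axes are proportional, and the quotient of
    their leading coefficients rewrites q b^T with the axis a. *)
Definition eprod (x y : code) : code :=
  if veq x.1 y.1 then (x.1, vadd x.2 y.2)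
  else normalize (vadd x.1 (smul (kmul (lead y.2) (ksq (lead x.2))) y.1), x.2).
Definition swap13 : data := ((e3, e2, e1), false, true).
(* One of the two elations y, x0 y for every four-group <x0, y> of kind k. *)
Definition reps (k : kind) : seq code :=
  match k with
  | KFlag => [:: (e1, smul kw e3)]
  | KGood => [seq dact d (e1, (k0, k1, l)) | l <- [:: k0; kw], d <- [:: id_data; swap13]]
  | KBad => [seq dact d x | x <- [seq (e1, (k0, m, l)) | m <- [:: kw; kw2], l <- [:: k0; kw]],
                          d <- [:: id_data; swap13]]
  end.
Definition rep (k : kind) : code := head x0 (reps k).

Definition same_map (c : bool) (x y z : code) : bool :=
  all (fun v => veq (fmat (elat x) c (fmat (elat y) c v)) (fmat (elat z) c v)) vall.

Definition check_commuting : bool :=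
  all (fun z => if ceq (dact (elat z) x0) x0 then commuting x0 z else true) allcodes.
Definition check_prod : bool :=
  all (fun z => if commuting x0 z && ~~ ceq x0 z then
    let y := eprod x0 z in
    [&& valid y, same_map false z x0 y, same_map true z x0 y &
      all (fun k => if krel k x0 z then
         [&& krel k z y, krel k y x0 &
           has (fun d => ceq (dact d x0) x0 && ceq (dact d z) (rep k)) stab_x0]
         else true) kinds]
    else true) allcodes.
Definition check_reps : bool :=
  all (fun k => all (fun z => krel k x0 z && valid z) (reps k) &&
      all (fun z => all (fun y => ~~ ceq (eprod x0 z) y) (reps k)) (reps k) &&
      all (fun z => if krel k x0 z then cmem z (reps k) || cmem (eprod x0 z) (reps k)
                     else true) allcodes)
  kinds.
Definition check_rel : bool :=
  all (fun k => all (fun z => if krel k x0 z then commuting x0 z && ~~ ceq z x0 else true)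
           allcodes)
  kinds.
Definition check_faithful : bool :=
  all (fun y => ceq x0 y ||
     has (fun v => ~~ veq (cross (fmat (elat x0) false v) (fmat (elat y) false v)) v0) vall)
    allcodes.
Definition check_involution : bool :=
  has (fun v => ~~ veq (cross (fmat (elat x0) false v) v) v0) vall &&
  all (fun v => all (fun c => veq (fmat (elat x0) c (fmat (elat x0) c v)) v) [:: true; false]) vall.
Definition check_det : bool :=
  all (all (fun d => keq (ddet d) k1))
    [:: stab_x0; center_moves; [:: id_data]; torus; parabolic1; parabolic2].

Lemma data_det i : all (fun d => keq (ddet d) k1)
  (nth [::] [:: stab_x0; center_moves; [:: id_data]; torus; parabolic1; parabolic2] i).
Proof.
have /allP h : check_det by vm_compute.
have [hi|hi] := ltnP i 6; first exact/h/mem_nth.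
by rewrite nth_default.
Qed.

Lemma det_data i d :
  d \in nth [::] [:: stab_x0; center_moves; [:: id_data]; torus; parabolic1; parabolic2] i -> ddet d = k1.
Proof. by have /allP h := data_det i; move/h/keqP. Qed.

Lemma valid_x0 : valid x0. Proof. by []. Qed.

(** Every code occurs in [cells], hence is reached from [x0] by successive maps of determinant 1.
    Stated as an induction principle, transitivity does not require composing data. *)
Lemma transitive_ind (T : code -> Prop) : T x0 ->
  (forall d x, ddet d = k1 -> valid x -> T x -> T (dact d x)) ->
  forall y, valid y -> T y.
Proof.
move=> T0 TS; pose ok (s : seq code) := forall x, x \in s -> valid x /\ T x.
have step (L : seq data) s : (forall d, d \in L -> ddet d = k1) -> ok s -> ok (layer L s).
  move=> hL hs _ /flattenP[_ /mapP[x /hs[vx Tx] ->] /mapP[d /hL d1 ->]].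
  by split; [apply: valid_act | apply: TS].
have ok0 : ok [:: x0] by move=> x; rewrite inE => /eqP->.
(* The nesting follows the definition of [cells]; 4, 5 and 3 are the positions of [parabolic1],
   [parabolic2] and [torus] in the list of [det_data]. *)
have okL := step _ _ (@det_data 4) (step _ _ (@det_data 5)
   (step _ _ (@det_data 4) (step _ _ (@det_data 3) ok0))).
have : check_trans by vm_compute.
rewrite /check_trans => /allP h.
by move=> y; rewrite -mem_allcodes => /h; rewrite cmemE => /okL[].
Qed.

Lemma rigid_ok : check_rigid rows.
Proof. by vm_compute. Qed.

Lemma seqn_eqP s t : reflect (s = t) (seqn_eq s t).
Proof.
apply: (iffP idP) => [|->]; last by elim: t => //= n t ->; rewrite andbT; apply/eqnP.
by elim: s t => [|m s IH] [|n t] //= /andP[/eqnP-> /IH->].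
Qed.

Lemma level_move i z : i < 7 -> valid z ->
  {in take i.+1 base, forall y, walks3 y z = walks3 y (nth x0 base i.+1)} ->
  exists2 d, d \in moves i & dact d z = nth x0 base i.+1 /\
    {in take i.+1 base, forall y, dact d y = y}.
Proof.
move=> hi vz hz; have := rigid_ok; rewrite /check_rigid => /andP[/allP/(_ i) + _].
rewrite mem_iota => /(_ hi); rewrite rowsE /check_level; cbv zeta.
have vb : valid (nth x0 base i.+1).
  by case: i hi {hz} => [|[|[|[|[|[|[|]]]]]]].
have T y : take i.+1 (signature y) = [seq walks3 u y | u <- take i.+1 base].
  by rewrite -map_take.
move: hz vb T; move: (nth x0 base i.+1) (take i.+1 base) => b c hz vb T.
(* Exactly one row of the table belongs to [b], so flattening returns its counts. *)
have -> : flatten [seq take i.+1 r.2 | r <- [seq (z, signature z) | z <- allcodes] & ceq r.1 b]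
    = take i.+1 (signature b).
  rewrite filter_map -map_comp.
  rewrite (eq_filter (a2 := pred1 b)); last by move=> x /=; apply/ceqP/eqP.
  rewrite filter_pred1_uniq; [|exact: uniq_allcodes|by rewrite mem_allcodes].
  exact: cats0.
move/allP/(_ (z, signature z));
  rewrite (map_f (fun z => (z, signature z))) ?mem_allcodes // => /(_ isT).
rewrite [(_, _).1]/= [(_, _).2]/=.
have -> : seqn_eq (take i.+1 (signature z)) (take i.+1 (signature b)).
  by apply/seqn_eqP; rewrite !T; apply/eq_in_map => y /hz.
case/hasP=> d hd; case: ceqP => // e /allP h; exists d => //; split=> // y /h.
by move/ceqP.
Qed.

Lemma base_resolving z z' : valid z -> valid z' ->
  {in base, forall y, walks3 y z = walks3 y z'} -> z = z'.
Proof.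
move=> vz vz' h; have := rigid_ok; rewrite /check_rigid => /andP[_]; rewrite rowsE.
move/allP/(_ (z, signature z));
  rewrite (map_f (fun z => (z, signature z))) ?mem_allcodes // => /(_ isT).
move/allP/(_ (z', signature z'));
  rewrite (map_f (fun z => (z, signature z))) ?mem_allcodes // => /(_ isT).
rewrite ![(_, _).1]/= ![(_, _).2]/=.
have -> : seqn_eq (signature z) (signature z') by apply/seqn_eqP/eq_in_map => y /h.
by move/ceqP.
Qed.

Lemma all_kinds (P : pred kind) : all P kinds -> forall k, P k.
Proof. by case/and4P=> h1 h2 h3 _ []. Qed.

Lemma commutingP z : valid z -> dact (elat z) x0 = x0 -> commuting x0 z.
Proof.
have : check_commuting by vm_compute.
rewrite /check_commuting => /allP h.
by rewrite -mem_allcodes => /h + e; rewrite e; case: ceqP.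
Qed.

(** The kind of a pair belongs to its four-group: going round the three involutions [x0], [z],
    [eprod x0 z] preserves it. Moreover elements fixing [x0] carry all [z] of one kind to a single
    representative. *)
Lemma eprodP z : valid z -> commuting x0 z -> z <> x0 ->
  [/\ valid (eprod x0 z),
      forall c v, fmat (elat z) c (fmat (elat x0) c v) = fmat (elat (eprod x0 z)) c v &
      forall k, krel k x0 z -> [/\ krel k z (eprod x0 z), krel k (eprod x0 z) x0 &
        exists2 d, d \in stab_x0 & dact d x0 = x0 /\ dact d z = rep k]].
Proof.
have : check_prod by vm_compute.
rewrite /check_prod => /allP h.
move=> vz cz nz; have := h z; rewrite mem_allcodes => /(_ vz); cbv zeta beta.
rewrite ifT; last by rewrite cz; case: ceqP => // e; case: nz.
case/and4P=> vp /allP m0 /allP m1 /all_kinds hk; split=> // [c v|k hr].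
  have hv : v \in vall by rewrite mem_vall.
  by case: c; apply/veqP; [apply: m1 | apply: m0].
have := hk k; rewrite ifT //; case/and3P=> -> -> /hasP[d hd /andP[/ceqP d0 /ceqP d2]].
by split=> //; exists d.
Qed.

Lemma rel_x0 k z : valid z -> krel k x0 z -> commuting x0 z /\ z <> x0.
Proof.
have : check_rel by vm_compute.
rewrite /check_rel => /all_kinds/(_ k)/allP h vz r.
by have := h z; rewrite mem_allcodes => /(_ vz); rewrite ifT // => /andP[-> /ceqP].
Qed.

Lemma commuting_rel z : commuting x0 z -> z <> x0 -> exists k, krel k x0 z.
Proof.
move=> c nz; have [f|nf] := boolP (sameFlag x0 z); first by exists KFlag.
have [g|ng] := boolP (good x0 z); first by exists KGood.
exists KBad; rewrite /krel /bad /adj (negPf nf) (negPf ng) c.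
by apply/ceqP=> h; apply: nz.
Qed.

Lemma repsP k : [/\ uniq (reps k),
  size (reps k) = match k with KFlag => 1 | KGood => 4 | KBad => 8 end,
  {in reps k, forall z, valid z /\ krel k x0 z},
  {in reps k &, forall z y, eprod x0 z <> y} &
  forall z, valid z -> krel k x0 z -> z \in reps k \/ eprod x0 z \in reps k].
Proof.
have /all_kinds/(_ k)/andP[/andP[/allP h1 /allP h2] /allP h3] : check_reps by vm_compute.
split.
- by case: k {h1 h2 h3}.
- by case: k {h1 h2 h3}.
- by move=> z /h1/andP[].
- by move=> z y /h2/allP h /h/ceqP.
move=> z vz r; have := h3 z; rewrite mem_allcodes r !cmemE => /(_ vz)/orP //.
Qed.

Lemma faithful_x0 y : valid y ->
  (forall v, v <> v0 -> cross (fmat (elat x0) false v) (fmat (elat y) false v) = v0) -> y = x0.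
Proof.
have : check_faithful by vm_compute.
rewrite /check_faithful => /allP h.
rewrite -mem_allcodes => /h /orP[/ceqP-> //|/hasP[v _ nv] hv].
have [e|nz] := veqP v v0; first by rewrite e !fmat0 in nv.
by rewrite hv in nv.
Qed.

Lemma involution_x0 : (forall c v, fmat (elat x0) c (fmat (elat x0) c v) = v) /\
  exists2 v, v <> v0 & cross (fmat (elat x0) false v) v <> v0.
Proof.
have /andP[/hasP[v _ hv] /allP h] : check_involution by vm_compute.
split=> [c u|].
  by have /and3P[/veqP h1 /veqP h2 _] := h u (mem_vall u); case: c.
exists v; first by move=> e; rewrite e fmat0 in hv.
by apply/veqP.
Qed.

From mathcomp Require Import ring.

(** * The group of collineations and correlations *)

Section Coordinates.
Import GRing.Theory.

(** Any [w] other than 0 and 1 will do: w^3 = 1 leaves w^2 + w + 1 = 0. Characteristic 2 comes from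
    -1 = (-1)^4 = 1. *)
Lemma F4_generator (F : finFieldType) : #|F| = 4 ->
  (1 + 1 = 0 :> F)%R /\ exists w : F, (w * w = 1 + w)%R.
Proof.
move=> F4; have pow4 (x : F) : (x ^+ 4 = x)%R by rewrite -[RHS]expf_card F4.
have opp1 : (-1 = 1 :> F)%R by rewrite -[LHS]pow4 -signr_odd expr0.
have D : (1 + 1 = 0 :> F)%R by rewrite -{2}opp1 subrr.
split=> //.
have [w /andP[w0 w1]] : exists w : F, (w != 0)%R && (w != 1)%R.
  apply/existsP; apply: contraT; rewrite negb_exists => /forallP h.
  have: #|F| <= #|[set (0 : F)%R; (1 : F)%R]|.
    rewrite -cardsT; apply/subset_leq_card/subsetP=> x _; rewrite !inE.
    by have := h x; rewrite negb_and !negbK.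
  by rewrite F4 cards2; case: (_ != _).
exists w; have : ((w - 1) * (w * w + w + 1) = 0)%R.
  have e : (w * (w ^+ 3 - 1) = 0)%R by rewrite mulrBr -exprS pow4 mulr1 subrr.
  move/eqP: e; rewrite mulf_eq0 (negPf w0) /= => /eqP e.
  by rewrite -[RHS]e !exprS expr0; ring.
move/eqP; rewrite mulf_eq0 subr_eq0 (negPf w1) /= => /eqP e.
have wE (x : F) : (x + x = 0)%R by rewrite -[x in LHS]mulr1 -mulrDr D mulr0.
have -> : (w * w = (w * w + w + 1) - (1 + w))%R by ring.
by apply/eqP; rewrite e sub0r eq_sym -addr_eq0 wE.
Qed.

Variables (F : finFieldType) (w : F).
Hypotheses (F4 : #|F| = 4) (two0 : (1 + 1 = 0 :> F)%R) (ww : (w * w = 1 + w)%R).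
Local Open Scope ring_scope.

Definition phi (x : K) : F := (if x.1 then 1 else 0) + (if x.2 then w else 0).

Lemma addxx (x : F) : x + x = 0.
Proof. by rewrite -[x in LHS]mulr1 -mulrDr two0 mulr0. Qed.

Lemma phi0 : phi k0 = 0. Proof. by rewrite /phi addr0. Qed.
Lemma phi1 : phi k1 = 1. Proof. by rewrite /phi addr0. Qed.

Lemma phiD x y : phi (kadd x y) = phi x + phi y.
Proof.
case: x => a b; case: y => c d; rewrite /phi addrACA; congr (_ + _) => /=.
  by case: a; case: c; rewrite ?(addr0, add0r, two0).
by case: b; case: d; rewrite ?(addr0, add0r, addxx).
Qed.

Lemma phiM x y : phi (kmul x y) = phi x * phi y.
Proof.
have w2 : w * (1 + w) = 1 by rewrite mulrDr mulr1 ww addrCA addxx addr0.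
case: x => [[] []]; case: y => [[] []];
  rewrite /phi /= ?(addr0, add0r, mulr0, mul0r, mulr1, mul1r, ww, w2) //.
- by rewrite mulrDl mul1r w2 addrAC two0 add0r.
- by rewrite mulrC w2.
Qed.

Lemma phi_eq0 x : (phi x == 0) = keq x k0.
Proof.
have [->|nz] := keqP; first by rewrite phi0 eqxx.
apply/negbTE/eqP=> e; have := phiM x (ksq x); rewrite kmulV // e mul0r phi1.
by move/eqP; rewrite oner_eq0.
Qed.

Lemma phi_inj : injective phi.
Proof.
move=> x y e; have : phi (kadd x y) == 0 by rewrite phiD e addxx.
by rewrite phi_eq0; case: x {e} => [[] []]; case: y => [[] []].
Qed.

Lemma phi_surj y : exists x, phi x = y.
Proof.
have [psi _ psiK] : bijective phi.
  by apply: (inj_card_bij phi_inj); rewrite F4 card_prod card_bool.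
by exists (psi y).
Qed.

Definition vnth (v : vec) (i : 'I_3) : K := nth k0 [:: v.1.1; v.1.2; v.2] i.
Definition mnth (A : mat) (i : 'I_3) : vec := nth v0 [:: A.1.1; A.1.2; A.2] i.
Definition cv (v : vec) : 'cV[F]_3 := \col_i phi (vnth v i).
Definition mx (A : mat) : 'M[F]_3 := \matrix_(i, j) phi (vnth (mnth A i) j).

Lemma sum3 (V : nmodType) (f : 'I_3 -> V) :
  \sum_i f i = f ord0 + f (lift ord0 ord0) + f (lift ord0 (lift ord0 ord0)).
Proof. by rewrite !big_ord_recl big_ord0 addr0 addrA. Qed.

Lemma phi_dot u v : phi (dot u v) = \sum_i phi (vnth u i) * phi (vnth v i).
Proof.
case: u => [[a b] c]; case: v => [[x y] z].
by rewrite sum3 /= !phiD !phiM.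
Qed.

Lemma cv_dot u v : (cv u)^T *m cv v = (phi (dot u v))%:M.
Proof.
apply/matrixP=> i j; rewrite !ord1 !mxE eqxx mulr1n phi_dot.
by apply: eq_bigr => k _; rewrite !mxE.
Qed.

Lemma cv_mul A v : mx A *m cv v = cv (mulv A v).
Proof.
apply/matrixP=> i j; rewrite !mxE.
transitivity (phi (dot (mnth A i) v)).
  by rewrite phi_dot; apply: eq_bigr => k _; rewrite !mxE.
by congr phi; case: A => [[r s] t]; case: i => [[|[|[|]]] hi].
Qed.

Lemma cv_smul k v : cv (smul k v) = phi k *: cv v.
Proof.
apply/matrixP=> i j; rewrite !mxE -phiM; congr phi.
by case: v => [[x y] z]; case: i => [[|[|[|]]] hi].
Qed.

Lemma cv_inj : injective cv.
Proof.
move=> [[a b] c] [[x y] z] /matrixP e.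
have E i := phi_inj (etrans (esym (mxE _ _ i 0)) (etrans (e i 0) (mxE _ _ i 0))).
have := E ord0; have := E (lift ord0 ord0); have := E (lift ord0 (lift ord0 ord0)).
by rewrite /vnth /= => -> -> ->.
Qed.

Lemma cv0 : cv v0 = 0.
Proof. by apply/matrixP=> i j; rewrite !mxE; case: i => [[|[|[|]]] hi]; rewrite ?phi0. Qed.

Lemma cv_eq0 v : (cv v == 0) = veq v v0.
Proof. by rewrite -cv0 (inj_eq cv_inj); apply/eqP/veqP. Qed.

Lemma cv_surj (x : 'cV[F]_3) : exists v, cv v = x.
Proof.
have [a ea] := phi_surj (x ord0 0); have [b eb] := phi_surj (x (lift ord0 ord0) 0).
have [c ec] := phi_surj (x (lift ord0 (lift ord0 ord0)) 0).
exists (a, b, c); apply/matrixP=> i j; rewrite !mxE ord1.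
case: i => [[|[|[|]]] hi] //; rewrite /vnth /= ?ea ?eb ?ec; congr (x _ _); exact: val_inj.
Qed.

Lemma mx_surj (M : 'M[F]_3) : exists A, mx A = M.
Proof.
have [r er] := cv_surj (row ord0 M)^T.
have [s es] := cv_surj (row (lift ord0 ord0) M)^T.
have [t et] := cv_surj (row (lift ord0 (lift ord0 ord0)) M)^T.
exists (r, s, t); apply/matrixP=> i j; rewrite !mxE.
have C v : phi (vnth v j) = cv v j 0 by rewrite mxE.
rewrite C; case: i => [[|[|[|]]] hi] //; rewrite /mnth /= ?er ?es ?et !mxE;
  congr (M _ _); exact: val_inj.
Qed.

Lemma oppr2 (x : F) : - x = x.
Proof. by apply/eqP; rewrite eq_sym -addr_eq0 addxx. Qed.

Lemma det_mx A : \det (mx A) = phi (kdet A).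
Proof.
rewrite (expand_det_row _ ord0) sum3 /cofactor.
rewrite !(expand_det_row _ ord0) !big_ord_recl !big_ord0 /cofactor !det_mx11 !mxE /=.
case: A => [[[[a b] c] [[a' b'] c']] [[a'' b''] c'']].
rewrite /vnth /mnth /= !phiD !phiM !phiD !phiM.
rewrite /bump /= !(add0n, addn0, addn1, add1n) !expr0 !exprS !expr0.
rewrite !(mulr1, mul1r, addr0, mulN1r, opprK) !oppr2; ring.
Qed.

(** By [dot_cof], A^T cof A and the identity define the same bilinear form. *)
Lemma mx_invT A : kdet A = k1 -> (invmx (mx A))^T = mx (cof A).
Proof.
move=> d1; have uA : mx A \in unitmx by rewrite unitmxE det_mx d1 phi1 unitr1.
suff e : (mx A)^T *m mx (cof A) = 1%:M.
  have uAT : (mx A)^T \in unitmx by rewrite unitmx_tr.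
  by apply: (can_inj (mulKmx uAT)); rewrite e trmx_inv mulmxV.
have ext (M N : 'M[F]_3) : (forall v, M *m cv v = N *m cv v) -> M = N.
  move=> h; apply/matrixP=> i j; have [v ev] := cv_surj (delta_mx j 0 : 'cV_3).
  by have /matrixP/(_ i 0) := h v; rewrite ev -!colE !mxE.
apply: ext => v; rewrite mul1mx -mulmxA cv_mul.
apply: trmx_inj; rewrite trmx_mul trmxK.
apply/matrixP=> i j; have [u eu] := cv_surj (delta_mx j 0 : 'cV_3).
have : ((cv (mulv (cof A) v))^T *m mx A *m cv u) i 0 = ((cv v)^T *m cv u) i 0.
  by rewrite -mulmxA cv_mul !cv_dot dot_cof.
by rewrite eu -!colE !mxE.
Qed.

Lemma field_aut_frob t :
  exists2 s : {perm F}, field_aut s & forall x, s (phi x) = phi (kfrob t x).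
Proof.
case: t; last by exists 1%g; [exact: field_aut1 | move=> x; rewrite perm1].
have sqphi x : phi x ^+ 2 = phi (ksq x) by rewrite ksqE phiM.
have inj : injective (fun x : F => x ^+ 2).
  move=> x y; have [a <-] := phi_surj x; have [b <-] := phi_surj y.
  rewrite !sqphi => /phi_inj e; congr phi; by rewrite -[a]ksqK e ksqK.
exists (perm inj); last by move=> x; rewrite permE sqphi.
apply/and3P; split; first by rewrite permE expr1n.
  apply/forallP=> x; apply/forallP=> y; rewrite !permE sqrrD.
  by rewrite mulr2n addxx addr0.
by apply/forallP=> x; apply/forallP=> y; rewrite !permE exprMn.
Qed.

Lemma frob_field_aut (s : {perm F}) : field_aut s ->
  exists t, forall x, s (phi x) = phi (kfrob t x).
Proof.
case/field_autP=> f ef.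
have [x ex] := phi_surj (f w).
have fphi t : f w = phi (kfrob t kw) -> forall x, s (phi x) = phi (kfrob t x).
  move=> e y; rewrite -ef /phi rmorphD; case: y => [[] []] /=;
  rewrite ?rmorph0 ?rmorph1 ?e /phi; case: (t); rewrite /= ?(add0r, addr0) //.
  by rewrite addrA two0 add0r.
(* The image of [w] is again a root of X^2 = X + 1, hence [w] or its square; [t] records which. *)
have: f w * f w = 1 + f w by rewrite -rmorphM ww rmorphD rmorph1.
rewrite -ex -phiM -phi1 -phiD => /phi_inj e.
case: x ex e => [[] []] // /esym ex _;
  by [exists true; apply: fphi | exists false; apply: fphi].
Qed.

Lemma cv_frob (s : {perm F}) t v : (forall x, s (phi x) = phi (kfrob t x)) ->
  map_mx s (cv v) = cv (frob t v).
Proof.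
move=> h; apply/matrixP=> i j; rewrite !mxE h; congr phi.
by case: t {h} => //; case: v => [[x y] z]; case: i => [[|[|[|]]] hi].
Qed.

Definition elt (c : bool) (v : 'cV[F]_3) := if c then ln v else pt v.

Lemma elt_pg c v : v != 0 -> is_pg_elt (elt c v).
Proof. by case: c; [apply: is_pg_ln | apply: is_pg_pt]. Qed.

Lemma pg_const : is_pg_elt (pt (const_mx 1 : 'cV[F]_3)).
Proof. by apply/is_pg_pt/eqP=> /matrixP/(_ ord0 ord0)/eqP; rewrite !mxE oner_eq0. Qed.

(** The zero vector has no meaning here and receives the point (1, 1, 1) as a default. *)
Definition pg_of (c : bool) (v : vec) : pg_elt F :=
  insubd (Sub (pt (const_mx 1)) pg_const : pg_elt F) (elt c (cv v)).

Lemma val_dec c v : v <> v0 -> val (pg_of c v) = elt c (cv v).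
Proof.
by move=> nz; rewrite val_insubd elt_pg // cv_eq0; apply/negP=> /veqP.
Qed.

Lemma dec_surj (x : pg_elt F) : exists c v, v <> v0 /\ x = pg_of c v.
Proof.
have [y nz ey] := pg_eltP x; have [v ev] := cv_surj y.
have hv : v <> v0 by apply/veqP; rewrite -cv_eq0 ev.
by case: ey => ey; [exists false, v | exists true, v]; split=> //; apply: val_inj;
  rewrite val_dec // ev ey.
Qed.

Lemma mem_pt_cv u v : u <> v0 -> v <> v0 -> (cv u \in pt (cv v)) = veq (cross u v) v0.
Proof.
move=> hu hv; apply/imsetP/veqP => [[k _]|h].
  have [l <-] := phi_surj k; rewrite -cv_smul => /cv_inj ->.
  by rewrite cross_swap cross_self.
have [k hk e] : exists2 k, k <> k0 & u = smul k v.
  by apply: cross0_smul; rewrite // cross_swap.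
by exists (phi k); rewrite // -cv_smul -e.
Qed.

Lemma mem_ln_cv u v : (cv u \in ln (cv v)) = keq (dot v u) k0.
Proof.
rewrite inE cv_dot -phi_eq0; apply/eqP/eqP=> [/matrixP/(_ 0 0)|->].
  by rewrite !mxE.
by apply/matrixP=> i j; rewrite !mxE mul0rn.
Qed.

Lemma dec_sub c u c' v : u <> v0 -> v <> v0 ->
  (val (pg_of c u) \subset val (pg_of c' v)) = incident c u c' v.
Proof.
move=> hu hv; rewrite !val_dec //; case: c; case: c'; rewrite /incident /=.
- apply/subsetP/veqP => [h|h x].
    apply: dot_perp_cross => x /keqP hx; apply/keqP; rewrite -mem_ln_cv.
    by apply: h; rewrite mem_ln_cv.
  have [y <-] := cv_surj x; have [k _ ->] := cross0_smul hu hv h.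
  rewrite !mem_ln_cv => /keqP e; apply/keqP.
  by rewrite -[y]smul1 dot_smul e; exact: kmul0.
(* A line lies in no point, since it contains two vectors that are not proportional. *)
- apply/negbTE/negP=> /subsetP h.
  have [x [y [hx hy]]] := perp_not_collinear hu; apply.
  have mult z : dot u z = k0 -> exists k, z = smul k v.
    move=> hz; have /imsetP[k _] : cv z \in pt (cv v).
      by apply: h; rewrite mem_ln_cv; apply/keqP.
    by have [l <-] := phi_surj k; rewrite -cv_smul => /cv_inj ->; exists l.
  have [k ->] := mult _ hx; have [l ->] := mult _ hy.
  by rewrite cross_smul cross_diag smul0.
- by have := pt_sub_pg (pg_of true v) (cv u); rewrite val_dec // mem_ln_cv.
by have := pt_sub_pg (pg_of false v) (cv u); rewrite val_dec // mem_pt_cv.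
Qed.

Lemma dec_eqP c u c' v : u <> v0 -> v <> v0 ->
  pg_of c u = pg_of c' v <-> c = c' /\ cross u v = v0.
Proof.
move=> hu hv; split=> [e|[<- h]].
  have := dec_sub c c' hu hv; have := dec_sub c' c hv hu.
  rewrite e subxx /incident; case: eqP => [-> /esym/veqP h _|h].
    by split=> //; rewrite cross_swap.
  by case: c h e; case: c'.
apply: val_inj; apply/eqP; rewrite eqEsubset !dec_sub // /incident eqxx.
by apply/andP; split; apply/veqP; rewrite // cross_swap.
Qed.

Definition induces (g : {perm pg_elt F}) (d : data) :=
  forall c v, v <> v0 -> g (pg_of c v) = pg_of (c (+) d.2) (fmat d c v).

Lemma repr_exists g : g \in coll_corr_det1 F -> exists2 d, ddet d = k1 & induces g d.
Proof.
case/det1_assocP=> b [M [s gM]]; have [hs /eqP dM _] := and3P gM.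
have [A eA] := mx_surj M; have [t et] := frob_field_aut hs.
have d1 : kdet A = k1 by apply: phi_inj; rewrite -det_mx eA dM phi1.
exists (A, t, b) => // c v nz; apply: val_inj.
have nzv : cv v != 0 by rewrite cv_eq0; apply/negP=> /veqP.
have := det1_assoc_elt gM nzv (val_dec c nz).
move=> ->; rewrite val_dec; last exact: fmat_nz.
by rewrite -eA (cv_frob _ et) /fmat; case: c; rewrite ?mx_invT // cv_mul.
Qed.

Lemma exists_repr d : ddet d = k1 -> exists2 g, g \in coll_corr_det1 F & induces g d.
Proof.
move=> d1.
(* Points and lines carry no preferred coordinates, so the image is picked through some choice of
   them; [dec_eqP] shows that the choice does not matter. *)
pose good_img x y := [exists z : bool * vec, [&& z.2 != v0, x == pg_of z.1 z.2 &
   y == pg_of (z.1 (+) d.2) (fmat d z.1 z.2)]].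
pose f x := odflt x [pick y | good_img x y].
have fE c v : v <> v0 -> f (pg_of c v) = pg_of (c (+) d.2) (fmat d c v).
  move=> nz; rewrite /f; case: pickP => [y|/(_ (pg_of (c (+) d.2) (fmat d c v)))]; last first.
    move/negbT/negP; case; apply/existsP; exists (c, v).
    by rewrite !eqxx !andbT; apply/eqP.
  case/existsP=> -[c' u] /= /and3P[/eqP nzu /eqP/(dec_eqP _ _ nz nzu)[<- h] /eqP->].
  apply/dec_eqP; [exact: fmat_nz | exact: fmat_nz | split=> //].
  by apply/veqP; rewrite fmat_cross0 //; apply/veqP; rewrite cross_swap.
have finj : injective f.
  move=> x y; have [c [u [hu ->]]] := dec_surj x; have [c' [v [hv ->]]] := dec_surj y.
  rewrite !fE // => /dec_eqP[||e]; [exact: fmat_nz | exact: fmat_nz |].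
  move/addIb: e => <- /(introT (veqP _ _)); rewrite fmat_cross0 // => /veqP h; exact/dec_eqP.
have [s hs es] := field_aut_frob d.1.2.
have gE : induces (perm finj) d by move=> c v nz; rewrite permE fE.
exists (perm finj) => //; apply/det1_assocP; exists d.2, (mx d.1.1), s.
have sub x y : (val (perm finj x) \subset val (perm finj y)) =
   if d.2 then val y \subset val x else val x \subset val y.
  have [c [u [hu ->]]] := dec_surj x; have [c' [v [hv ->]]] := dec_surj y.
  rewrite !gE // !dec_sub //; try exact: fmat_nz.
  by rewrite incident_fmat //; case: (d.2).
have pE (x : pg_elt F) (v : 'cV[F]_3) : v != 0 -> val x = pt v ->
    val (perm finj x) = elt d.2 (mx d.1.1 *m map_mx s v).
  have [u <-] := cv_surj v; rewrite cv_eq0 => /(elimN (veqP _ _)) nz ex.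
  have -> : x = pg_of false u by apply: val_inj; rewrite val_dec.
  rewrite gE // val_dec; last exact: fmat_nz.
  by rewrite (cv_frob _ es) cv_mul; case: (d) => [[A t] b].
apply/and3P; split=> //; first by rewrite det_mx -phi1; apply/eqP; congr phi.
case: (d.2) sub pE => sub pE; apply/andP; split;
  (apply/forallP=> x; apply/forallP=> y; first [by rewrite sub |
   by apply/implyP=> /andP[nz /eqP e]; apply/eqP/pE]).
Qed.

End Coordinates.

(** * From semilinear maps to the abstract group *)

Local Open Scope group_scope.

Lemma vadd_cancel u v w : vadd u v = vadd u w -> v = w.
Proof.
case: u => [[a b] c]; case: v => [[x y] z]; case: w => [[x' y'] z'] /= [].
have D m n p : kadd m n = kadd m p -> n = p.
  by case: m => [[] []]; case: n => [[] []]; case: p => [[] []].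
by move=> /D-> /D-> /D->.
Qed.

Lemma vadd_eq0 u v : vadd u v = v0 -> u = v.
Proof.
case: u => [[a b] c]; case: v => [[x y] z] /= [].
have D m n : kadd m n = k0 -> m = n by case: m => [[] []]; case: n => [[] []].
by move=> /D-> /D-> /D->.
Qed.

Lemma fmat_inj d c : ddet d = k1 -> injective (fmat d c).
Proof.
move=> d1 u v e; apply: vadd_eq0; apply/veqP; apply: contraT => /veqP nz.
case: (fmat_nz d1 (c := c) nz); rewrite fmatD e.
by case: (fmat d c v) => [[[[] []] [[] []]] [[] []]].
Qed.

(** A vector with a . v = 1 gives p = (b . v) q. Both centres have leading coefficient 1, so b . v =
    1 and p = q; then a and b agree on all vectors. *)
Lemma vtrans_inj x y : valid x -> valid y ->
  (forall v, vtrans x false v = vtrans y false v) -> x = y.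
Proof.
case: x y => p a [q b] /validP[lp /flagP[hp ha _]] /validP[lq /flagP[hq hb _]] h.
rewrite /= in lp hp ha lq hq hb.
have {}h v : smul (dot a v) p = smul (dot b v) q by apply: vadd_cancel (h v).
have [v] := dot_nondeg ha; rewrite dotC => ev.
have ep := h v; rewrite ev smul1 in ep.
have bv : dot b v <> k0 by move=> e; apply: hp; rewrite ep e smul0v.
have bv1 : dot b v = k1.
  by move: (lead_smul q bv); rewrite -ep lp lq kmulC kmul1.
rewrite bv1 smul1 in ep; rewrite ep in h *; congr (_, _).
apply: vadd_eq0; apply/veqP; apply: contraT => /veqP /dot_nondeg[u].
rewrite dotC dot_vadd => e; have := congr1 lead (h u).
have L k : lead (smul k q) = k.
  have [->|nz] := keqP k k0; first by rewrite smul0v.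
  by rewrite lead_smul // lq kmulC kmul1.
by rewrite !L => e'; move: e; rewrite e'; case: (dot b u) => [[] []].
Qed.

Lemma act_inj d x y : ddet d = k1 -> valid x -> valid y -> dact d x = dact d y -> x = y.
Proof.
move=> d1 vx vy e; apply: vtrans_inj => // v; apply: (fmat_inj d1 (c := false)).
by rewrite !fmat_vtrans_act ?e //; apply: valid_flag.
Qed.

Lemma act_surj d y : ddet d = k1 -> valid y -> exists2 x, valid x & dact d x = y.
Proof.
move=> d1 vy; pose s := map (dact d) allcodes.
have us : uniq s.
  rewrite map_inj_in_uniq; first exact: uniq_allcodes.
  by move=> u v; rewrite !mem_allcodes; apply: act_inj.
have ss : {subset s <= allcodes}.
  by move=> _ /mapP[x + ->]; rewrite !mem_allcodes; apply: valid_act.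
have [|_ h] := uniq_min_size us ss; first by rewrite size_map leqnn.
have /mapP[x vx ->] : y \in s by rewrite h mem_allcodes.
by exists x; rewrite // -mem_allcodes.
Qed.

(** A duality would send the axes [e2] and [e3], both on the centre [e1], to the one centre [e1],
    against injectivity. Otherwise every point is the centre and every line the axis of some
    elation, so all of them are fixed. *)
Lemma act_fix d : ddet d = k1 -> (forall x, valid x -> dact d x = x) ->
  d.2 = false /\ forall c v, v <> v0 -> cross (fmat d c v) v = v0.
Proof.
move=> d1 h; have d2 : d.2 = false.
  apply/negbTE/negP=> d2.
  have E a : valid (e1, a) -> exists2 k, k <> k0 & fmat d true a = smul k e1.
    move=> va; have hl := raw_lead d1 (valid_flag va); have := h _ va.
    rewrite actE; rewrite /raw d2 in hl * => -[e _].
    by exists (lead (fmat d true a)); rewrite -1?e ?smulA ?kmulV ?smul1.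
  have [k _ ek] := E e2 isT; have [l _ el] := E e3 isT.
  have := fmat_cross d1 true e2 e3; rewrite ek el cross_smul cross_diag smul0.
  by move/esym; apply: fmat_nz.
have E p a : valid (p, a) -> cross (fmat d false p) p = v0 /\ cross (fmat d true a) a = v0.
  move=> va; have := h _ va; rewrite actE.
  have := raw_lead d1 (valid_flag va); rewrite /raw d2 /= => hl [ep ea].
  by rewrite -{2}ep -{2}ea !cross_self.
have P v : v <> v0 -> exists2 x, x <> v0 & dot v x = k0.
  move/perp_not_collinear=> [x [y [hx _ nc]]]; exists x => // x0_.
  by apply: nc; rewrite x0_; case: (y) => [[[[] []] [[] []]] [[] []]].
split=> // c v nz; have [x hx hv] := P v nz.
have S k l u u' : k <> k0 -> l <> k0 ->
    cross (smul k u) (smul l u') = v0 -> cross u u' = v0.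
  move=> hk hl; rewrite cross_smul => e; apply/veqP; apply: contraT => /veqP.
  by move/(smul_nz (kmul_nz hk hl)).
case: c.
  have lx := lead_nz hx; have vx : valid (normalize (x, v)).
    by apply: valid_normalize; apply/flagP; split.
  have [_] := E _ _ vx; rewrite fmat_smul //; apply: S => //.
  exact: kfrob_nz.
have lv := @kfrob_nz true _ (lead_nz nz); have vx : valid (normalize (v, x)).
  by apply: valid_normalize; apply/flagP; split=> //; rewrite dotC.
have [+ _] := E _ _ vx; rewrite fmat_smul //; apply: S => //.
exact: kfrob_nz.
Qed.

(* What the rest of the proof needs to know about G: the images e x of the
   elations, and the conjugation action of G on them. *)
Record model (gT : finGroupType) (G : {group gT}) (e : code -> gT) : Prop := Model {
  model_mem : forall x, valid x -> e x \in G;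
  model_inj : forall x y, valid x -> valid y -> e x = e y -> x = y;
  model_act : forall d, ddet d = k1 ->
    exists2 g, g \in G & forall x, valid x -> e x ^ g = e (dact d x);
  model_data : forall g, g \in G ->
    exists2 d, ddet d = k1 & forall x, valid x -> e x ^ g = e (dact d x);
  model_conj : forall x y, valid x -> valid y -> e y ^ e x = e (dact (elat x) y);
  model_mul : forall x, valid x -> commuting x0 x -> x <> x0 -> e x0 * e x = e (eprod x0 x);
  model_center : forall p a b, valid (p, a) -> valid (p, b) -> valid (p, vadd a b) ->
    e (p, a) * e (p, b) = e (p, vadd a b);
  model_neq1 : e x0 != 1;
  model_involution : e x0 * e x0 = 1;
  model_faithful : forall g, g \in G -> (forall x, valid x -> e x ^ g = e x) -> g = 1 }.

Lemma model_isom (gT hT : finGroupType) (G : {group gT}) (H : {group hT})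
    (f : {morphism G >-> hT}) e : isom G H f -> model G e -> model H (f \o e).
Proof.
case/isomP=> /injmP finj fG m; have [m1 m2 m3 m4 m5 m6 m6' m7 m8 m9] := m.
have inH g : g \in G -> f g \in H by move=> Gg; rewrite -fG mem_morphim.
have J g x : g \in G -> valid x -> f (e x) ^ f g = f (e x ^ g).
  by move=> Gg vx; rewrite morphJ ?m1.
have pre g : g \in H -> exists2 g', g' \in G & g = f g'.
  by rewrite -fG => /morphimP[g' _ Gg' ->]; exists g'.
have v0 := valid_x0.
split=> /=.
- by move=> x vx; apply/inH/m1.
- by move=> x y vx vy /finj h; apply: m2; rewrite // h ?m1.
- move=> d /m3[g Gg hg]; exists (f g); first exact: inH.
  by move=> x vx; rewrite J // hg.
- move=> _ /pre[g Gg ->]; have [d d1 hd] := m4 g Gg; exists d => // x vx.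
  by rewrite J // hd.
- by move=> x y vx vy; rewrite J ?m5 ?m1.
- by move=> x vx cx nx; rewrite -morphM ?m6 ?m1.
- by move=> p a b va vb vc; rewrite -morphM ?m6' ?m1.
- apply/eqP=> h; case/eqP: m7; apply: (finj _ _ (m1 _ v0) (group1 G)).
  by rewrite morph1.
- by rewrite -morphM ?m1 // m8 morph1.
move=> _ /pre[g Gg ->] h; rewrite (m9 g) ?morph1 // => x vx.
by apply: finj; rewrite ?groupJ ?m1 // -J ?h.
Qed.

Section PlaneModel.
Variables (F : finFieldType) (w : F).
Hypotheses (F4 : #|F| = 4) (two0 : (1 + 1 = 0 :> F)%R) (ww : (w * w = 1 + w)%R).
Local Notation pg_of := (pg_of w).
Local Notation induces := (induces w).

Lemma repr_eq (g h : {perm pg_elt F}) :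
  (forall c v, v <> v0 -> g (pg_of c v) = h (pg_of c v)) -> g = h.
Proof.
by move=> e; apply/permP=> x; have [c [v [nz ->]]] := dec_surj F4 two0 ww x;
  apply: e. Qed.

Lemma elat1 x : valid x -> ddet (elat x) = k1.
Proof. by case/validP=> _ /flagP[_ _]; apply: elat_det. Qed.

Lemma elat2 x : (elat x).2 = false.
Proof. by case: x => [[[p q] r] [[a b] c]]. Qed.

Lemma plane_model : exists e, model (coll_corr_det1_group F) e.
Proof.
have [e he] : exists e : code -> {perm pg_elt F}, forall x, valid x ->
    e x \in coll_corr_det1 F /\ induces (e x) (elat x).
  apply: (fin_all_exists (P := fun x g => valid x ->
    g \in coll_corr_det1 F /\ induces g (elat x))) => x.
  have [vx|nv] := boolP (valid x); last by exists 1.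
  have [g gP rg] := exists_repr F4 two0 ww (elat1 vx).
  by exists g.
have nzE x c v : valid x -> v <> v0 -> fmat (elat x) c v <> v0.
  by move=> vx; apply: fmat_nz; apply: elat1.
have eE x c v : valid x -> v <> v0 -> e x (pg_of c v) = pg_of c (fmat (elat x) c v).
  by move=> vx nz; rewrite (proj2 (he x vx) c v nz) elat2 addbF.
have vt x c v : valid x -> fmat (elat x) c v = vtrans x c v.
  by case/validP=> _ /flagP[_ _ h]; apply: fmat_elat.
have J g d x : ddet d = k1 -> induces g d -> valid x -> e x ^ g = e (dact d x).
  move=> d1 rg vx; have va := valid_act d1 vx.
  (* Products of permutations apply the left factor first: it remains to compare [g] after [e x]
     with [e (dact d x)] after [g]. *)
  rewrite conjgE; apply: (mulgI g); rewrite mulKVg; apply: repr_eq => c v nz.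
  have nf b := fmat_nz d1 (c := b) nz.
  rewrite !permM (eE _ _ _ vx nz) (rg _ _ (nzE _ _ _ vx nz)) (rg _ _ nz).
  rewrite (eE _ _ _ va (nf _)) !vt //.
  by rewrite fmat_vtrans_act //; apply: valid_flag.
have inj0 y : valid y -> e y = e x0 -> y = x0.
  move=> vy ey; apply: faithful_x0 => // v nz.
  have := eE x0 false v valid_x0 nz; rewrite -ey eE //.
  by case/(dec_eqP F4 two0 ww _ _ (nzE _ _ _ vy nz) (nzE _ _ _ valid_x0 nz))=> _; rewrite cross_swap.
have A d : ddet d = k1 -> exists2 g, g \in coll_corr_det1 F &
    forall x, valid x -> e x ^ g = e (dact d x).
  move=> d1; have [g gP rg] := exists_repr F4 two0 ww d1; exists g => // x vx; exact: J.
have inj x y : valid x -> valid y -> e x = e y -> x = y.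
  move=> vx; move: x vx y.
  (* Injectivity is computed only at [x0] and carried to the other elations by conjugation. *)
  apply: (transitive_ind (T := fun x => forall y, valid y -> e x = e y -> x = y)).
    by move=> y vy ey; rewrite (inj0 y).
  move=> d x d1 vx IH y vy; have [z vz <-] := act_surj d1 vy.
  by have [g _ hg] := A d d1; rewrite -!hg // => /conjg_inj/IH->.
exists e; split=> //.
- by move=> x /he[].
- move=> g gP; have [d d1 rg] := repr_exists F4 two0 ww gP; exists d => // x vx; exact: J.
- by move=> x y vx vy; apply: J => //; [apply: elat1 | have [] := he x vx].
- move=> x vx cx nx; have [vp hp _] := eprodP vx cx nx; apply: repr_eq => c v nz.
  by rewrite permM !eE ?hp //; apply: nzE.
- move=> p a b va vb vc; apply: repr_eq => c v nz.
  rewrite permM !eE ?vt //; last by rewrite -vt //; apply: nzE.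
  have [/validP[_ /flagP[_ _ ha]] /validP[_ /flagP[_ _ hb]]] := (va, vb).
  by rewrite vtrans_vadd.
- have [_ [v nz hv]] := involution_x0; apply/eqP=> e1.
  have := eE x0 false v valid_x0 nz; rewrite e1 perm1.
  case/(dec_eqP F4 two0 ww _ _ nz (nzE _ _ _ valid_x0 nz))=> _ h; apply: hv.
  by rewrite cross_swap.
- have [h _] := involution_x0; apply: repr_eq => c v nz.
  by rewrite permM perm1 !eE ?h //; apply: nzE.
move=> g gP h; have [d d1 rg] := repr_exists F4 two0 ww gP.
have [d2 hd] : d.2 = false /\ forall c v, v <> v0 -> cross (fmat d c v) v = v0.
  apply: act_fix => // x vx; apply: inj => //; first exact: valid_act.
  by rewrite -(J _ _ _ d1 rg) // h.
apply: repr_eq => c v nz; rewrite rg // perm1 d2 addbF.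
by apply/(dec_eqP F4 two0 ww) => //; [apply: fmat_nz | split; last exact: hd].
Qed.

End PlaneModel.

Lemma model_exists (F : finFieldType) (F4 : #|F| = 4) (gT : finGroupType)
  (G : {group gT}) (isoG : G \isog coll_corr_det1 F) : exists e, model G e.
Proof.
have [two0 [w ww]] := F4_generator F4; have [e m] := plane_model F4 two0 ww.
have /isogP : (coll_corr_det1 F) \isog G by rewrite isog_sym.
by case=> f inj fG; exists (f \o e); apply: model_isom m; apply/isomP.
Qed.

(** * Rigidity and central involutions *)

Lemma gen_klein (gT : finGroupType) (a b : gT) : a * a = 1 -> b * b = 1 -> a * b = b * a ->
  <<[set a; b]>> = [set 1; a; b; a * b].
Proof.
move=> aa bb ab; apply/eqP; rewrite eqEsubset; apply/andP; split; last first.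
  have Va : a \in <<[set a; b]>> by apply: mem_gen; rewrite !inE eqxx.
  have Vb : b \in <<[set a; b]>> by apply: mem_gen; rewrite !inE eqxx orbT.
  by apply/subsetP=> z; rewrite !inE -!orbA => /or4P[] /eqP->; rewrite ?group1 ?groupM.
have gset : group_set [set 1; a; b; a * b].
  apply/group_setP; split; first by rewrite !inE eqxx.
  have aab : a * (a * b) = b by rewrite mulgA aa mul1g.
  have bab : b * (a * b) = a by rewrite ab mulgA bb mul1g.
  have aba : a * b * a = b by rewrite ab -mulgA aa mulg1.
  have abb : a * b * b = a by rewrite -mulgA bb mulg1.
  have abab : a * b * (a * b) = 1 by rewrite -mulgA bab aa.
  by move=> x y; rewrite !inE -!orbA => /or4P[] /eqP-> /or4P[] /eqP->;
    rewrite ?mul1g ?mulg1 ?aa ?bb -?ab ?aab ?bab ?aba ?abb ?abab eqxx ?orbT.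
by rewrite (gen_subG _ (Group gset)) /= subUset !sub1set !inE !eqxx ?orbT.
Qed.

Lemma index_norm_genJ (gT : finGroupType) (G : {group gT}) (a b g : gT) : g \in G ->
  #|G : 'N_G(<<[set a ^ g; b ^ g]>>)| = #|G : 'N_G(<<[set a; b]>>)|.
Proof.
move=> Gg; rewrite -[in RHS](indexJg _ _ g) conjIg -normJ -genJ conjUg !conjg_set1.
by rewrite conjGid.
Qed.

Section Model.
Variables (gT : finGroupType) (G : {group gT}) (e : code -> gT).
Hypothesis m : model G e.

Definition implements (g : gT) (s : code -> code) :=
  forall x, valid x -> e x ^ g = e (s x).

(** The inverse is the action of data representing g^-1. It also reverses the implication that
    [good_act] and [sameFlag_act] give. *)
Lemma act_auto d : ddet d = k1 -> exists t, isauto (dact d) t.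
Proof.
move=> d1; have [g Gg hg] := model_act m d1.
have [d' d1' hd'] := model_data m (groupVr Gg).
have K x : valid x -> dact d' (dact d x) = x.
  move=> vx; apply: (model_inj m) => //; first by rewrite !valid_act.
  by rewrite -hd' ?valid_act // -hg // conjgK.
have K' x : valid x -> dact d (dact d' x) = x.
  move=> vx; apply: (model_inj m) => //; first by rewrite !valid_act.
  by rewrite -hg ?valid_act // -hd' // conjgKV.
have I c x y : ddet c = k1 -> valid x -> valid y -> adj x y -> adj (dact c x) (dact c y).
  move=> c1 /valid_flag fx /valid_flag fy /orP[] h; apply/orP; [left|right].
    exact: good_act.
  exact: sameFlag_act.
exists (dact d'); split=> // [x vx|x vx|x y vx vy]; try exact: valid_act.
apply/idP/idP; last exact: I.
by move/(I _ _ _ d1' (valid_act d1 vx) (valid_act d1 vy)); rewrite !K.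
Qed.

Lemma rel_act d k x y : ddet d = k1 -> valid x -> valid y ->
  krel k x y -> krel k (dact d x) (dact d y).
Proof.
move=> d1 vx vy; have [fx fy] := (valid_flag vx, valid_flag vy).
case: k; [exact: sameFlag_act | exact: good_act | rewrite /= /bad].
case: ifP => // cxy /andP[na /ceqP nxy]; rewrite commuting_act //.
have [t at_] := act_auto d1; rewrite (auto_adj at_) // na.
by apply/ceqP=> /(act_inj d1 vx vy).
Qed.

Lemma auto_comp s t s' t' : isauto s t -> isauto s' t' -> isauto (s' \o s) (t \o t').
Proof.
case=> a1 a2 a3 a4 a5 [b1 b2 b3 b4 b5]; split=> /=.
- by move=> x vx; apply/b1/a1.
- by move=> x vx; apply/a2/b2.
- by move=> x vx; rewrite b3 ?a3 //; apply: a1.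
- by move=> x vx; rewrite a4 ?b4 //; apply: b2.
by move=> x y vx vy; rewrite b5 ?a5 //; apply: a1.
Qed.

Lemma to_x0 x : valid x -> exists2 d, ddet d = k1 & dact d x = x0.
Proof.
move: x; apply: transitive_ind; first by exists id_data; rewrite // act_id_data.
move=> d x d1 vx [c c1 cx]; have [g Gg hg] := model_act m d1.
have [d' d1' hd'] := model_data m (groupVr Gg).
have [h Gh hh] := model_act m c1.
have [f f1 hf] := model_data m (groupM (groupVr Gg) Gh).
exists f => //; have va := valid_act d1 vx.
apply: (model_inj m); [exact: valid_act | exact: valid_x0 |].
by rewrite -hf // conjgM -hg // conjgK hh // cx.
Qed.

Lemma to_x0_group x : valid x -> exists2 g, g \in G & e x ^ g = e x0 /\
  exists2 d, ddet d = k1 & dact d x = x0 /\ implements g (dact d).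
Proof.
move=> vx; have [d d1 dx] := to_x0 vx; have [g Gg hg] := model_act m d1.
by exists g => //; split; [rewrite hg // dx | exists d].
Qed.

Lemma base_valid y : y \in base -> valid y.
Proof. by move: y; apply/allP. Qed.

(** The subgroup and the starting level are parameters because the descent serves twice: with [G]
    from level 0 for rigidity, and with [center1] from level 2 for the centralizer of [center1]. *)
Lemma chain (S : {group gT}) i : i <= 7 ->
  (forall j d, i <= j < 7 -> d \in moves j -> ddet d = k1 /\
     exists2 g, g \in S & implements g (dact d)) ->
  forall s t, isauto s t -> {in take i.+1 base, forall y, s y = y} ->
  exists2 g, g \in S & forall x, valid x -> e (s x) ^ g = e x.
Proof.
move En: (7 - i) => n; elim: n i En => [|n IH] i En hi hS s t st fixs.
  have i7 : i = 7 by apply/eqP; rewrite eqn_leq hi -subn_eq0 En.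
  exists 1; rewrite ?group1 // => x vx; rewrite conjg1; congr e.
  have vs := auto_valid st vx.
  apply: base_resolving => // y yb; have sy : s y = y by apply: fixs; rewrite i7.
  by rewrite -{1}sy; apply: walks3_auto st (base_valid yb) vx.
have lt7 : i < 7 by rewrite -subn_gt0 En.
have bv : nth x0 base i.+1 \in base by apply: mem_nth.
have vb := base_valid bv.
have [y yi|d dm [db df]] := level_move lt7 (auto_valid st vb).
  rewrite -{1}(fixs y yi); apply: walks3_auto st _ vb.
  by apply: base_valid; apply: mem_take yi.
have [d1 [g Sg hg]] : ddet d = k1 /\ exists2 g, g \in S & implements g (dact d).
  by apply: hS dm; rewrite leqnn lt7.
have [t' at'] := act_auto d1.
have En' : 7 - i.+1 = n by rewrite subnS En.
have hS' j c : i < j < 7 -> c \in moves j -> ddet c = k1 /\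
    exists2 g, g \in S & implements g (dact c).
  by case/andP=> /ltnW ij j7; apply: hS; rewrite ij.
have fix' : {in take i.+2 base, forall y, (dact d \o s) y = y}.
  move=> y; rewrite (take_nth x0) // mem_rcons inE.
  by case/predU1P=> [->|yi] //=; rewrite fixs ?df.
have [g' Sg' hg'] := IH i.+1 En' lt7 hS' _ _ (auto_comp st at') fix'.
exists (g * g'); first exact: groupM.
move=> x vx; rewrite conjgM (hg _ (auto_valid st vx)); exact: hg'.
Qed.

Lemma rigid s t : isauto s t ->
  exists2 g, g \in G & forall x, valid x -> e (s x) ^ g = e x.
Proof.
move=> st; have vs := auto_valid st valid_x0.
have [d d1 dx] := to_x0 vs; have [g Gg hg] := model_act m d1.
have [t' at'] := act_auto d1.
have hS j c : 0 <= j < 7 -> c \in moves j -> ddet c = k1 /\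
    exists2 g, g \in G & implements g (dact c).
  move=> _ cm; have c1 : ddet c = k1.
    case: j cm => [|[|[|[|j]]]]; first exact: (@det_data 0).
    - exact: (@det_data 0).
    - exact: (@det_data 1).
    - exact: (@det_data 1).
    by rewrite /moves nth_default // inE => /eqP->.
  by split=> //; have [h Gh hh] := model_act m c1; exists h.
have fix0 : {in take 1 base, forall y, (dact d \o s) y = y}.
  by move=> y; rewrite inE => /eqP->.
have [g' Gg' hg'] := chain (leq0n 7) hS (auto_comp st at') fix0.
exists (g * g'); first exact: groupM.
move=> x vx; rewrite conjgM (hg _ (auto_valid st vx)); exact: hg'.
Qed.

(** * The elations are the central involutions *)

Definition involutions := [set e x | x : code & valid x].

Lemma class_x0 : e x0 ^: G = involutions.
Proof.
apply/setP=> z; apply/imsetP/imsetP=> [[g Gg ->]|[x]].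
  have [d d1 hd] := model_data m Gg; exists (dact d x0); last by rewrite hd.
  by rewrite inE valid_act.
rewrite inE => /to_x0_group[g Gg [hg _]] ->.
by exists g^-1; rewrite ?groupV // -hg conjgK.
Qed.

Lemma card_involutions : #|involutions| = 315.
Proof.
rewrite card_in_imset; last first.
  by move=> x y; rewrite !inE => vx vy; apply: (model_inj m).
have -> : #|[set x | valid x]| = #|allcodes|.
  by apply: eq_card => x; rewrite inE mem_allcodes.
rewrite (card_uniqP uniq_allcodes); exact: size_allcodes.
Qed.

Lemma index_cent_x0 : #|G : 'C_G[e x0]| = 315.
Proof. by rewrite index_cent1 class_x0 card_involutions. Qed.

Lemma square x : valid x -> e x * e x = 1.
Proof.
move=> vx; have [g Gg [hg _]] := to_x0_group vx.
by apply: (conjg_inj g); rewrite conjMg hg (model_involution m) conj1g.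
Qed.

Lemma neq1 x : valid x -> e x != 1.
Proof.
move=> vx; have [g Gg [hg _]] := to_x0_group vx.
by rewrite -(inj_eq (conjg_inj g)) hg conj1g (model_neq1 m).
Qed.

Lemma invol_inv x : valid x -> (e x)^-1 = e x.
Proof. by move=> vx; apply/eqP; rewrite eq_invg_mul square. Qed.

Lemma order_e x : valid x -> #[e x] = 2.
Proof.
move=> vx; apply: nt_prime_order => //; last exact: neq1.
by rewrite expgS expg1 square.
Qed.

Lemma central_x0 : central_involution G (e x0).
Proof.
have Ge := model_mem m valid_x0.
rewrite /central_involution Ge order_e //=.
have [H sylH] := Sylow_exists 2 'C_G[e x0].
apply/existsP; exists H; have [sHC pH iH] := and3P sylH.
have sCG : 'C_G[e x0] \subset G by apply: subsetIl.
apply/andP; split; last first.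
  by rewrite inE Ge -sub_cent1; apply: subset_trans sHC (subsetIr _ _).
rewrite /pHall (subset_trans sHC sCG) pH -(Lagrange_index sCG sHC) pnatM iH andbT.
by rewrite index_cent_x0 p'natE.
Qed.

Lemma centralJ g z : g \in G -> central_involution G z -> central_involution G (z ^ g).
Proof.
move=> Gg /and3P[Gz oz /existsP[H /andP[sH cH]]].
rewrite /central_involution groupJ // orderJ oz /=.
apply/existsP; exists (H :^ g)%G; rewrite pHallJ // sH /=.
have [_ cz] := setIP cH.
by rewrite inE groupJ //= centJ memJ_conjg.
Qed.

Lemma central_e x : valid x -> central_involution G (e x).
Proof.
move=> vx; have [g Gg [hg _]] := to_x0_group vx.
by rewrite -[e x](conjgK g) hg; apply: centralJ central_x0; rewrite groupV.
Qed.

Definition center1 : {set gT} := 1 |: [set e x | x : code & valid x && (x.1 == e1)].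

Lemma center1_group_set : group_set center1.
Proof.
apply/group_setP; split; first exact: setU11.
have mem_c a : valid (e1, a) -> e (e1, a) \in center1.
  by move=> va; apply/setU1r/imsetP; exists (e1, a); rewrite // inE va eqxx.
move=> x y /setU1P[->|/imsetP[[p a]]]; first by rewrite mul1g.
rewrite inE => /andP[+ /eqP/= ep] -> ; rewrite ep => va {p ep}.
case/setU1P=> [->|/imsetP[[p b]]]; first by rewrite mulg1 mem_c.
rewrite inE => /andP[+ /eqP/= ep] -> ; rewrite ep => vb {p ep}.
have [<-|nab] := eqVneq a b; first by rewrite square // setU11.
have vc : valid (e1, vadd a b).
  have [_ /flagP[_ _ ha]] := validP _ va; have [_ /flagP[_ _ hb]] := validP _ vb.
  apply/validP; split=> //; apply/flagP; split=> //=.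
    by move/vadd_eq0=> h; rewrite h eqxx in nab.
  rewrite dot_vadd ha hb //.
by rewrite (model_center m) // mem_c.
Qed.
Canonical center1_group := Group center1_group_set.

Lemma center1_sub : center1 \subset G.
Proof.
apply/subsetP=> z /setU1P[->|/imsetP[x]]; first exact: group1.
by rewrite inE => /andP[vx _] ->; apply: (model_mem m).
Qed.

Lemma center1_pgroup : 2.-group center1.
Proof.
apply/pgroupP=> p pr /Cauchy[//|z zE oz]; rewrite inE -oz.
case/setU1P: zE oz => [->|/imsetP[x]]; first by rewrite order1 => e1_; rewrite -e1_ in pr.
by rewrite inE => /andP[vx _] -> _; rewrite order_e.
Qed.

(* An element centralizing all elations with centre e1 fixes the first three base
   points, so by [chain] it acts as a product of elations with centre e1. *)
Lemma cent_center1 z : z \in G -> z \in 'C(center1) -> z \in center1.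
Proof.
move=> Gz cz; have [d d1 hd] := model_data m Gz.
have [t dt] := act_auto d1.
have fixd y : valid y -> y.1 == e1 -> dact d y = y.
  move=> vy ey; apply: (model_inj m) => //; first by rewrite valid_act.
  rewrite -hd //; apply/conjg_fixP/commgP/commute_sym/(centP cz).
  by apply/setU1r/imsetP; exists y; rewrite // inE vy.
have fix3 : {in take 3 base, forall y, dact d y = y}.
  by move=> y; rewrite !inE => /or3P[] /eqP->; apply: fixd.
have hS j c : 2 <= j < 7 -> c \in moves j -> ddet c = k1 /\
    exists2 g, g \in center1_group & implements g (dact c).
  have id_ : exists2 g, g \in center1_group & implements g (dact id_data).
    by exists 1; rewrite ?group1 // => x vx; rewrite conjg1 act_id_data.
  have H f : f \in center_moves -> ddet f = k1 /\
      exists2 g, g \in center1_group & implements g (dact f).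
    move=> hf; split; first exact: (@det_data 1).
    case/allpairsPdep: hf => k [l [_ _ ->]].
    have [v|nv] := boolP (valid (e1, (k0, k, l))).
      exists (e (e1, (k0, k, l))); last by move=> x vx; apply: (model_conj m).
      by apply/setU1r/imsetP; exists (e1, (k0, k, l)); rewrite // inE v eqxx.
    (* Only k = l = 0 is left, where the data are those of the identity. *)
    by move: nv; case: k => [[] []]; case: l => [[] []].
  case: j => [|[|[|[|j]]]] // _; rewrite /moves; [exact: H | exact: H |].
  by rewrite nth_default // inE => /eqP->.
have [g Sg hg] := chain (isT : 2 <= 7) hS dt fix3.
have -> : z = g^-1.
  have Gg : g \in G by apply: (subsetP center1_sub).
  apply: (mulIg g); rewrite mulVg.
  apply: (model_faithful m); first exact: groupM.
  by move=> x vx; rewrite conjgM hd ?hg.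
by rewrite groupV.
Qed.

Lemma centralP z : reflect (exists2 x, valid x & z = e x) (central_involution G z).
Proof.
apply: (iffP idP) => [|[x vx ->]]; last exact: central_e.
case/and3P=> Gz /eqP oz /existsP[H /andP[sH cH]].
(* The Sylow subgroup centralized by [z] contains a conjugate of [center1]; conjugated back, [z]
   centralizes [center1] and so belongs to it. *)
have [g Gg sJ] := Sylow_Jsub sH center1_sub center1_pgroup.
have zJ : z ^ g^-1 \in center1.
  apply: cent_center1; first by rewrite groupJ ?groupV.
  have [_ cz] := setIP cH.
  rewrite -mem_conjg -centJ; apply: subsetP cz; exact: centS.
have /setU1P[h|/imsetP[x]] := zJ.
  have z1 : z = 1 by apply: (conjg_inj g^-1); rewrite h conj1g.
  by rewrite z1 order1 in oz.
rewrite inE => /andP[vx _] ez; have [d d1 hd] := model_data m Gg.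
exists (dact d x); first by rewrite valid_act.
by rewrite -hd // -ez conjgKV.
Qed.

(** [G] is transitive on the ordered pairs of each kind: [x] goes to [x0], then an element fixing
    [x0] moves the second member to [rep k]. *)
Lemma pair_trans k x y : valid x -> valid y -> krel k x y ->
  exists2 g, g \in G & e x ^ g = e x0 /\ e y ^ g = e (rep k).
Proof.
move=> vx vy r; have [g Gg [hg [d d1 [dx hd]]]] := to_x0_group vx.
have vd := valid_act d1 vy.
have r0 : krel k x0 (dact d y) by rewrite -dx; apply: rel_act.
have [cy ny] := rel_x0 vd r0.
have [_ _ /(_ _ r0)[_ _ [c /(@det_data 0) c1 [c0 cz]]]] := eprodP vd cy ny.
have [h Gh hh] := model_act m c1; exists (g * h); first exact: groupM.
by rewrite !conjgM !hd // dx !hh ?valid_x0 // c0 cz.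
Qed.

(** * Lines *)

Definition klein z := <<[set e x0; e z]>>.

Lemma commute_x0 z : valid z -> commuting x0 z -> z <> x0 -> e x0 * e z = e z * e x0.
Proof.
move=> vz cz nz; have [vp _ _] := eprodP vz cz nz.
by rewrite (model_mul m) // -(invol_inv vp) -(model_mul m) // invMg !invol_inv ?valid_x0.
Qed.

Lemma kleinE z : valid z -> commuting x0 z -> z <> x0 ->
  klein z = [set 1; e x0; e z; e (eprod x0 z)].
Proof.
move=> vz cz nz; rewrite /klein gen_klein ?square ?valid_x0 //.
  by rewrite (model_mul m).
exact: commute_x0.
Qed.

Lemma klein_prod z : valid z -> commuting x0 z -> z <> x0 ->
  klein (eprod x0 z) = klein z.
Proof.
move=> vz cz nz; have [vp _ _] := eprodP vz cz nz.
have h := model_mul m vz cz nz.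
have ez : e z = e x0 * e (eprod x0 z) by rewrite -h mulgA square ?valid_x0 // mul1g.
have K0 y : e x0 \in klein y by rewrite mem_gen // !inE eqxx.
have K1 y : e y \in klein y by rewrite mem_gen // !inE eqxx orbT.
apply/eqP; rewrite eqEsubset; apply/andP.
split; rewrite gen_subG subUset !sub1set K0 /=; first by rewrite -h groupM ?K0 ?K1.
by rewrite ez groupM ?K0 ?K1.
Qed.

Section Index.
Variables (k : kind) (z : code).
Hypotheses (vz : valid z) (rz : krel k x0 z).
Let w := eprod x0 z.
Let N := 'N_G(klein z).
Let C := 'C_G[e x0].

(* With C the centralizer of e x0 and N the normalizer of the four-group V:
   |G : N| |N : N_C(V)| = |G : C| |C : N_C(V)|, where |N : N_C(V)| = 3 as N is
   transitive on the involutions of V, and |G : C| = 315. *)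
Lemma index_klein_rel : #|G : N| = (105 * size (reps k))%N.
Proof.
have v0 := valid_x0; have [cz nz] := rel_x0 vz rz.
have [vw _ /(_ _ rz)[rzw rw0 _]] := eprodP vz cz nz.
have VE := kleinE vz cz nz.
have V0 : e x0 \in klein z by rewrite VE !inE eqxx orbT.
have Vz : e z \in klein z by rewrite VE !inE eqxx !orbT.
have Vw : e w \in klein z by rewrite VE !inE eqxx !orbT.
(* Both (x0, z) and (x, y) are conjugate to (x0, [rep k]). The resulting element maps generators of
   the four-group into it, so it normalizes the four-group and takes [x0] to [x]. *)
have mover x y : valid x -> valid y -> e x \in klein z -> e y \in klein z -> krel k x y ->
    e x \in e x0 ^: N.
  move=> vx vy Vx Vy rxy; have [g Gg [gx gy]] := pair_trans vx vy rxy.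
  have [h Gh [hx hy]] := pair_trans v0 vz rz.
  have Gf : h * g^-1 \in G by rewrite groupM ?groupV.
  apply/imsetP; exists (h * g^-1); last by rewrite conjgM hx -gx conjgK.
  rewrite inE Gf inE -genJ gen_subG; apply/subsetP=> _ /imsetP[u + ->].
  case/set2P=> ->; rewrite conjgM; first by rewrite hx (canLR (conjgK g) (esym gx)).
  by rewrite hy (canLR (conjgK g) (esym gy)).
have class3 : e x0 ^: N = [set e x0; e z; e w].
  apply/eqP; rewrite eqEsubset; apply/andP; split; last first.
    apply/subsetP=> u; rewrite !inE -orbA => /or3P[] /eqP->.
    - exact: mover rz.
    - exact: mover rzw.
    exact: mover rw0.
  apply/subsetP=> _ /imsetP[n /setIP[_ Nn] ->].
  have : e x0 ^ n \in klein z by rewrite -(normP Nn) memJ_conjg.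
  rewrite VE !inE -!orbA => /or4P[/eqP h| -> | -> | ->]; rewrite ?orbT //.
  by case/eqP: (neq1 v0); apply: (conjg_inj n); rewrite h conj1g.
have ewE : e w = e x0 * e z by rewrite (model_mul m).
have card3 : #|[set e x0; e z; e w]| = 3.
  have n1 : e x0 != e z.
    by apply/eqP=> /(model_inj m v0 vz) h; apply: nz; rewrite h.
  have n2 : e x0 != e w by rewrite ewE eq_mulVg1 mulKg neq1.
  have n3 : e z != e w by rewrite ewE commute_x0 // eq_mulVg1 mulKg neq1.
  by rewrite -setUA !cardsU1 cards1 !inE negb_or n1 n2 n3.
have kleinJ y c : valid y -> c \in C -> klein y :^ c = <<[set e x0; e y ^ c]>>.
  move=> vy /setIP[_ /cent1P cc]; rewrite /klein -genJ conjUg !conjg_set1.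
  by rewrite (_ : e x0 ^ c = e x0) //; apply/conjg_fixP/commgP/commute_sym.
have [ur _ hr hsep hcov] := repsP k.
(* The conjugates of the four-group under the centralizer of [e x0] are the four-groups of the same
   kind on [x0], and [reps k] names each of them once. *)
have conjE : klein z :^: C = [set klein y | y in reps k].
  apply/eqP; rewrite eqEsubset; apply/andP; split; apply/subsetP=> V.
    case/imsetP=> c Cc ->; have [d d1 hd] := model_data m (subsetP (subsetIl _ _) _ Cc).
    have dx : dact d x0 = x0.
      apply: (model_inj m); rewrite ?valid_act // -hd //.
      by apply/conjg_fixP/commgP/commute_sym/cent1P; case/setIP: Cc.
    have vd := valid_act d1 vz.
    have rd : krel k x0 (dact d z) by rewrite -{1}dx; apply: rel_act.
    have -> : klein z :^ c = klein (dact d z) by rewrite kleinJ // hd.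
    case: (hcov _ vd rd) => h; first by apply/imsetP; exists (dact d z).
    have [cd nd] := rel_x0 vd rd.
    by apply/imsetP; exists (eprod x0 (dact d z)); rewrite // klein_prod.
  case/imsetP=> y /hr[vy ry] ->; have [g Gg [gx gy]] := pair_trans v0 vy ry.
  have [h Gh [hx hy]] := pair_trans v0 vz rz.
  have cC : h * g^-1 \in C.
    rewrite inE groupM ?groupV //; apply/cent1P/commute_sym/commgP/conjg_fixP.
    by rewrite conjgM hx -{1}gx conjgK.
  apply/imsetP; exists (h * g^-1) => //.
  by rewrite kleinJ // conjgM hy -gy conjgK.
have cardconj : #|C : 'N_C(klein z)| = size (reps k).
  rewrite -card_conjugates conjE card_in_imset; first exact/card_uniqP.
  move=> y y' Ry Ry' eV; have [vy ry] := hr _ Ry; have [vy' ry'] := hr _ Ry'.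
  have [[cy ny] [cy' ny']] := (rel_x0 vy ry, rel_x0 vy' ry').
  have [vp _ _] := eprodP vy cy ny.
  have : e y' \in klein y by rewrite eV mem_gen // !inE eqxx orbT.
  rewrite kleinE // !inE -!orbA => /or4P[/eqP h|/eqP/(model_inj m vy' v0)//|
    /eqP/(model_inj m vy' vy)//|/eqP/(model_inj m vy' vp) h].
    by have := neq1 vy'; rewrite h eqxx.
  by case: (hsep _ _ Ry Ry').
have inter : 'N_C(klein z) = 'C_N[e x0].
  by rewrite /N /C setIAC.
have sCG : C \subset G by apply: subsetIl.
have sNG : N \subset G by apply: subsetIl.
have sNC : 'N_C(klein z) \subset C by apply: subsetIl.
have sCN : 'C_N[e x0] \subset N by apply: subsetIl.
have cN : #|N : 'C_N[e x0]| = 3 by rewrite index_cent1 class3 card3.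
have LN : (#|G : N| * 3 = #|G : 'C_N[e x0]|)%N by rewrite -cN Lagrange_index.
have LC : (315 * size (reps k) = #|G : 'N_C(klein z)|)%N.
  by rewrite -cardconj -index_cent_x0 Lagrange_index.
apply/eqP; rewrite -(eqn_pmul2r (isT : 0 < 3)) LN -inter -LC.
by rewrite (_ : 315 = 105 * 3)%N // mulnAC.
Qed.
End Index.

Lemma index_pair k x y : valid x -> valid y -> krel k x y ->
  #|G : 'N_G(<<[set e x; e y]>>)| = (105 * size (reps k))%N.
Proof.
move=> vx vy r; have [g Gg [gx gy]] := pair_trans vx vy r.
have [vr rr] : valid (rep k) /\ krel k x0 (rep k).
  by have [_ _ h _ _] := repsP k; apply: h; case: (k).
by rewrite -(index_klein_rel vr rr) /klein -gx -gy index_norm_genJ.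
Qed.

Lemma to_x0_inv x : valid x -> exists g d d', [/\ g \in G, ddet d = k1, ddet d' = k1,
  dact d x = x0 & [/\ implements g (dact d), implements g^-1 (dact d') &
  forall y, valid y -> dact d' (dact d y) = y]].
Proof.
case/to_x0_group=> g Gg [_ [d d1 [dx hd]]].
have [d' d1' hd'] := model_data m (groupVr Gg).
exists g, d, d'; split=> //; split=> // y vy.
apply: (model_inj m) => //; first by rewrite !valid_act.
by rewrite -hd' ?valid_act // -hd // conjgK.
Qed.

Lemma commute_rel x y : valid x -> valid y -> x <> y -> e x * e y = e y * e x ->
  exists k, krel k x y.
Proof.
move=> vx vy nxy cxy; have [g [d [d' [Gg d1 d1' dx [hd hd' K]]]]] := to_x0_inv vx.
have vd := valid_act d1 vy.
have ny : dact d y <> x0 by rewrite -dx => /(act_inj d1 vy vx)/esym.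
have c0 : commuting x0 (dact d y).
  apply: commutingP => //; apply: (model_inj m) => //.
    by rewrite valid_act // elat1.
  rewrite -(model_conj m) //; apply/conjg_fixP/commgP.
  by rewrite -dx -!hd //; rewrite /commute -!conjMg cxy.
have [k r] := commuting_rel c0 ny; exists k.
by rewrite -(K x vx) -(K y vy) dx; apply: rel_act.
Qed.

Lemma rel_prod k x y : valid x -> valid y -> krel k x y ->
  [/\ x <> y, e x * e y = e y * e x &
      exists z, [/\ valid z, e x * e y = e z, krel k y z & krel k z x]].
Proof.
move=> vx vy r; have [g [d [d' [Gg d1 d1' dx [hd hd' K]]]]] := to_x0_inv vx.
have vd := valid_act d1 vy.
have r0 : krel k x0 (dact d y) by rewrite -dx; apply: rel_act.
have [cy ny] := rel_x0 vd r0; have [vp _ /(_ _ r0)[r1 r2 _]] := eprodP vd cy ny.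
split.
- by move=> exy; apply: ny; rewrite -exy.
- by apply: (conjg_inj g); rewrite !conjMg !hd // dx commute_x0.
exists (dact d' (eprod x0 (dact d y))); split.
- by rewrite valid_act.
- by rewrite -hd' // -(model_mul m) // -dx -!hd // -conjMg conjgK.
- by rewrite -{1}(K y vy); apply: rel_act.
by rewrite -(K x vx) dx; apply: rel_act; rewrite ?valid_x0.
Qed.

Lemma adj_rel x y : adj x y -> exists2 k, krel k x y & size (reps k) \in [:: 1%N; 4].
Proof. by case/orP=> h; [exists KGood | exists KFlag]. Qed.

Lemma rel_adj k x y : krel k x y -> size (reps k) \in [:: 1%N; 4] -> adj x y.
Proof. by case: k => //= h _; rewrite /adj h ?orbT. Qed.

(** * Collinearity and automorphisms of the near octagon *)

Local Notation T := (O2_point G).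

Definition code_of (u : T) : code := odflt x0 [pick x | valid x && (e x == val u)].
Definition point_of (x : code) : T := insubd (Sub (e x0) central_x0 : T) (e x).

Lemma code_ofP u : valid (code_of u) /\ e (code_of u) = val u.
Proof.
rewrite /code_of; case: pickP => [x /andP[vx /eqP ex] // | h].
have /centralP[x vx ex] := valP u.
by have := h x; rewrite vx ex eqxx.
Qed.

Lemma val_point_of x : valid x -> val (point_of x) = e x.
Proof. by move=> vx; rewrite val_insubd central_e. Qed.

Lemma point_ofK x : valid x -> code_of (point_of x) = x.
Proof.
move=> vx; have [vc ec] := code_ofP (point_of x).
by apply: (model_inj m); rewrite // ec val_point_of.
Qed.

Lemma code_ofK u : point_of (code_of u) = u.
Proof. by have [vc ec] := code_ofP u; apply: val_inj; rewrite val_point_of. Qed.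

Lemma code_of_eq u x : valid x -> val u = e x -> code_of u = x.
Proof.
move=> vx ex; rewrite -(point_ofK vx); congr code_of; apply: val_inj.
by rewrite val_point_of.
Qed.

Lemma line_adj (L : {set T}) u v : L \in O2_lines G -> u \in L -> v \in L -> u != v ->
  adj (code_of u) (code_of v).
Proof.
rewrite inE => /existsP[x /existsP[y /and4P[nxy /eqP cxy idx /eqP eL]]] uL vL nuv.
have [[vx ex] [vy ey]] := (code_ofP x, code_ofP y).
have [k r] : exists k, krel k (code_of x) (code_of y).
  apply: commute_rel => //; last by rewrite ex ey.
  by move=> h; case/eqP: nxy; rewrite -(code_ofK x) h code_ofK.
(* The index is 105, 420 or 840, so the condition on lines excludes exactly the kind [KBad]. *)
have hk : size (reps k) \in [:: 1%N; 4].
  move: idx; rewrite -ex -ey (index_pair vx vy r); by case: (k).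
have [_ _ [z [vz ez r1 r2]]] := rel_prod vx vy r.
have [a1 a2 a3] := And3 (rel_adj r hk) (rel_adj r1 hk) (rel_adj r2 hk).
have cmem t : t \in L -> [\/ code_of t = code_of x, code_of t = code_of y | code_of t = z].
  move=> tL; have : val t \in val @: L by apply: imset_f.
  rewrite eL !inE -orbA -ex -ey ez => /or3P[] /eqP h; [apply: Or31|apply: Or32|apply: Or33];
  exact: code_of_eq h.
have nc : code_of u <> code_of v.
  by move=> h; case/eqP: nuv; rewrite -(code_ofK u) h code_ofK.
by case: (cmem u uL) (cmem v vL) nc => -> [] -> // _; rewrite // adj_sym.
Qed.

Lemma adj_line u v : adj (code_of u) (code_of v) ->
  u != v /\ exists L, [/\ L \in O2_lines G, u \in L & v \in L].
Proof.
case/adj_rel=> k r hk; have [[vu eu] [vv ev]] := (code_ofP u, code_ofP v).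
have [nuv cuv [z [vz ez _ _]]] := rel_prod vu vv r.
have {}nuv : u != v by apply/eqP=> h; apply: nuv; rewrite h.
split=> //; exists [set t : T | val t \in [set val u; val v; val u * val v]].
split; rewrite !inE ?eqxx ?orbT //.
apply/existsP; exists u; apply/existsP; exists v; rewrite nuv -eu -ev cuv eqxx /=.
rewrite (index_pair vu vv r); apply/andP; split; first by case: (k) hk.
apply/eqP/setP=> t; apply/imsetP/idP=> [[t' + ->]|ht]; first by rewrite inE -cuv.
have [x vx ex] : exists2 x, valid x & t = e x.
  move: ht; rewrite !inE -cuv ez -orbA => /or3P[] /eqP->;
  by [exists (code_of u) | exists (code_of v) | exists z].
exists (point_of x); last by rewrite val_point_of.
by rewrite inE val_point_of // -ex ?cuv.
Qed.

Lemma geom_aut_adj (s : {perm T}) u v : s \in geom_aut (O2_lines G) ->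
  adj (code_of u) (code_of v) -> adj (code_of (s u)) (code_of (s v)).
Proof.
rewrite inE => /forall_inP hs /adj_line[nuv [L [hL uL vL]]].
by apply: (line_adj (hs L hL)); rewrite ?imset_f // (inj_eq perm_inj).
Qed.

Lemma geom_aut_conj (s : {perm T}) : s \in geom_aut (O2_lines G) ->
  exists2 g, g \in G & forall u, val (s u) = val u ^ g.
Proof.
move=> sA; have sVA : s^-1 \in geom_aut (O2_lines G) by rewrite groupV.
pose f (r : {perm T}) x := code_of (r (point_of x)).
have vf r x : valid (f r x) by have [] := code_ofP (r (point_of x)).
have fadj r x y : r \in geom_aut (O2_lines G) -> valid x -> valid y ->
    adj x y -> adj (f r x) (f r y).
  by move=> rA vx vy axy; apply: geom_aut_adj => //; rewrite !point_ofK.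
have fK x : valid x -> f s^-1 (f s x) = x.
  by move=> vx; rewrite /f code_ofK permK point_ofK.
have fVK x : valid x -> f s (f s^-1 x) = x.
  by move=> vx; rewrite /f code_ofK permKV point_ofK.
have af : isauto (f s) (f s^-1).
  split=> // x y vx vy; apply/idP/idP; last exact: fadj.
  by move/(fadj _ _ _ sVA (vf _ _) (vf _ _)); rewrite !fK.
(* Conjugation by [g] undoes the automorphism, which is therefore conjugation by the inverse. *)
have [g Gg hg] := rigid af; exists g^-1; rewrite ?groupV // => u.
have [vu eu] := code_ofP u; have [_ es] := code_ofP (s u).
by rewrite -es -eu -(hg _ vu) conjgK /f code_ofK.
Qed.

Lemma conj_geom_aut (s : {perm T}) g : g \in G -> (forall u, val (s u) = val u ^ g) ->
  s \in geom_aut (O2_lines G).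
Proof.
move=> Gg hs; rewrite inE; apply/forall_inP=> L.
rewrite !inE => /existsP[x /existsP[y /and4P[nxy /eqP cxy idx /eqP eL]]].
apply/existsP; exists (s x); apply/existsP; exists (s y); rewrite !hs (inj_eq perm_inj) nxy.
rewrite -!conjMg cxy eqxx /= -cxy.
rewrite index_norm_genJ // idx /=.
rewrite -imset_comp (eq_imset _ hs) (imset_comp (conjg^~ g) val) eL.
by rewrite !imsetU !imset_set1.
Qed.

(* Conjugation by 1 outside G, so that [conj_point g] is always injective. *)
Definition conj_point (g : gT) (u : T) : T := insubd u (val u ^ (if g \in G then g else 1)).

Lemma val_conj_point g u : val (conj_point g u) = val u ^ (if g \in G then g else 1).
Proof.
rewrite val_insubd centralJ //; [by case: ifP | exact: valP].
Qed.

Lemma conj_point_inj g : injective (conj_point g).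
Proof.
move=> u v h; apply: val_inj; apply: (conjg_inj (if g \in G then g else 1)).
by rewrite -!val_conj_point h.
Qed.

Definition conj_perm (g : gT) : {perm T} := perm (@conj_point_inj g).

Lemma val_conj_perm g u : g \in G -> val (conj_perm g u) = val u ^ g.
Proof. by move=> Gg; rewrite permE val_conj_point Gg. Qed.

Lemma conj_permM : {in G &, {morph conj_perm : g h / g * h}}.
Proof.
move=> g h Gg Gh; apply/permP=> u; apply: val_inj.
by rewrite permM !val_conj_perm ?groupM // conjgM.
Qed.
Canonical conj_perm_morphism := Morphism conj_permM.

Lemma geom_aut_isog : geom_aut (O2_lines G) \isog G.
Proof.
rewrite isog_sym; apply/isogP; exists conj_perm_morphism.
  apply/subsetP=> g /morphpreP[Gg /set1P h]; apply/set1P.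
  apply: (model_faithful m) => // x vx.
  by rewrite -(val_point_of vx) -val_conj_perm // [conj_perm g]h perm1.
apply/setP=> s; apply/morphimP/idP=> [[g _ Gg ->]|sA].
  by apply: (conj_geom_aut Gg) => u; apply: val_conj_perm.
have [g Gg hg] := geom_aut_conj sA; exists g => //.
by apply/permP=> u; apply: val_inj; rewrite hg val_conj_perm.
Qed.

End Model.

Theorem theorem1p3 (F : finFieldType) (F4 : #|F| = 4)
    (gT : finGroupType) (G : {group gT}) (isoG : G \isog coll_corr_det1 F) :
  geom_aut (O2_lines G) \isog G /\
  forall s : {perm O2_point G},
    s \in geom_aut (O2_lines G) <->
    exists2 g : gT, g \in G & forall x : O2_point G, val (s x) = val x ^ g.
Proof.
have [e m] := model_exists F4 isoG; split; first exact: geom_aut_isog m.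
by move=> s; split=> [|[g Gg]]; [exact: (geom_aut_conj m) | apply: conj_geom_aut].
Qed.
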